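(* Let $d\ge 2$ and $n\ge 1$ be integers, let $1\le p_1,\dots,p_n\le\infty$, and let $r\in(0,\infty]$ be given by $\frac1r=\frac1{p_1}+\cdots+\frac1{p_n}$. Then the $n$-linear spherical average operator $\mathcal A^n$ maps $L^{p_1}(\mathbb R^d)\times\cdots\times L^{p_n}(\mathbb R^d)$ to $L^r(\mathbb R^d)$; that is, there is a constant $C<\infty$, depending only on $d,n,p_1,\dots,p_n$, such that for all nonnegative Schwartz functions $f_1,\dots,f_n$ on $\mathbb R^d$, $$\|\mathcal A^n(f_1,\dots,f_n)\|_{L^r(\mathbb R^d)}\le C\,\|f_1\|_{L^{p_1}(\mathbb R^d)}\cdots\|f_n\|_{L^{p_n}(\mathbb R^d)}.$$
   Context: Let $\sigma_{nd-1}$ denote the surface measure on the unit sphere $\mathbb S^{nd-1}$ of $\mathbb R^{nd}=(\mathbb R^d)^n$, whose points are written $(y_1,\dots,y_n)$ with $y_i\in\mathbb R^d$. For nonnegative Schwartz functions $f_1,\dots,f_n$ on $\mathbb R^d$ and $x\in\mathbb R^d$, define $$\mathcal A^n(f_1,\dots,f_n)(x)=\int_{\mathbb S^{nd-1}}f_1(x-y_1)\cdots f_n(x-y_n)\,d\sigma_{nd-1}(y_1,\dots,y_n).$$ Here $1/\infty=0$. For $0<r<\infty$, $\|f\|_{L^r}=\big(\int_{\mathbb R^d}|f(x)|^r\,dx\big)^{1/r}$ (a quasi-norm if $r<1$), and $\|\cdot\|_{L^\infty}$ is the essential supremum norm. *)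

(* Defs.v *)
From HB Require Import structures.
From mathcomp Require Import all_boot all_order all_algebra.
From mathcomp Require Import all_classical all_reals all_analysis.
From mathcomp Require Import measurable_realfun.

Set Implicit Arguments.
Unset Strict Implicit.
Unset Printing Implicit Defensive.

Import Order.TTheory GRing.Theory Num.Theory.
Import numFieldTopology.Exports numFieldNormedType.Exports.

Local Open Scope classical_set_scope.
Local Open Scope ring_scope.

(* R^d is 'rV[R]_d and (R^d)^n = R^(nd) is
   'M[R]_(n, d), the point (y_1, ..., y_n) being the matrix with rows y_i. *)

Definition measure_matrix_display : measure_display -> measure_display.
Proof. exact. Qed.

(* The product sigma-algebra, generated by the entries. Over R it is the Borel
   sigma-algebra of 'M[R]_(m, n). *)
Section measurable_matrix.
Context {d} {T : sigmaRingType d} (m n : nat).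

Definition mx_entry (k : 'I_(m * n)) (A : 'M[T]_(m, n)) : T := mxvec A ord0 k.

Let matrix_set0 : g_sigma_preimage mx_entry set0.
Proof. exact: sigma_algebra0. Qed.

Let matrix_setC A : g_sigma_preimage mx_entry A ->
  g_sigma_preimage mx_entry (~` A).
Proof. exact: sigma_algebraC. Qed.

Let matrix_bigcup (F : _^nat) : (forall i, g_sigma_preimage mx_entry (F i)) ->
  g_sigma_preimage mx_entry (\bigcup_i (F i)).
Proof. exact: sigma_algebra_bigcup. Qed.

HB.instance Definition _ := @isMeasurable.Build (measure_matrix_display d)
  'M[T]_(m, n) (g_sigma_preimage mx_entry) matrix_set0 matrix_setC
  matrix_bigcup.

End measurable_matrix.

Section measurable_matrix_theory.
Context d0 (T0 : measurableType d0) d1 (T : measurableType d1) (m n : nat).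

Lemma measurable_mx_entry (i : 'I_m) (j : 'I_n) :
  measurable_fun [set: 'M[T]_(m, n)] (fun A => A i j).
Proof.
move=> _ Y mY; rewrite setTI; apply: sub_sigma_algebra => /=.
rewrite -bigcup_seq/=; exists (mxvec_index i j) => /=.
  by rewrite mem_index_enum.
exists Y => //; rewrite setTI; apply/seteqP.
by split=> A; rewrite /mx_entry /= mxvecE.
Qed.

Lemma measurable_fun_mx (f : T0 -> 'M[T]_(m, n)) :
  (forall i j, measurable_fun [set: T0] (fun x => f x i j)) ->
  measurable_fun [set: T0] f.
Proof.
move=> mf.
apply: measurability; first by [].
move=> _ [B + <-]; rewrite -bigcup_seq => -[k _ [C mC <-]].
case/mxvec_indexP: k => i j; rewrite !setTI.
rewrite (_ : _ @^-1` _ = (fun x => f x i j) @^-1` C).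
  by rewrite -[X in measurable X]setTI; exact: mf.
by apply/seteqP; split=> x /=; rewrite /mx_entry /= mxvecE.
Qed.

End measurable_matrix_theory.

Definition pushforward_measure d1 d2 (T1 : measurableType d1)
    (T2 : measurableType d2) (R : realFieldType)
    (mu : {measure set T1 -> \bar R}) (f : T1 -> T2)
    (mf : measurable_fun [set: T1] f) : {measure set T2 -> \bar R} :=
  @measure_function_pushforward__canonical__measure_function_Measure
    _ _ T1 T2 R mu f mf.

Lemma sigma_finite_pushforward d1 d2 (T1 : measurableType d1)
    (T2 : measurableType d2) (R : realType)
    (mu : set T1 -> \bar R) (f : T1 -> T2) (g : T2 -> T1) :
  sigma_finite [set: T1] mu -> measurable_fun [set: T2] g -> cancel f g ->
  sigma_finite [set: T2] (pushforward mu f).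
Proof.
move=> [F UF Foo] mg fg.
exists (fun k => g @^-1` F k); first by rewrite -preimage_bigcup -UF.
move=> k; have [mF Fk] := Foo k; split.
  by rewrite -[X in measurable X]setTI; exact: mg.
rewrite /pushforward (_ : f @^-1` _ = F k)//.
by apply/seteqP; split=> x /=; rewrite fg.
Qed.

Section lebesgue_measure_matrix.
Context (R : realType).

Section tuple_step.
Variables (n : nat) (mu : {sigma_finite_measure set (n.-tuple R) -> \bar R}).

Let R1 := measurableTypeR R.

Let nu : {measure set (R1 * n.-tuple R)%type -> \bar R} :=
  (lebesgue_measure \x mu)%E.

Let sigma_finite_nu : sigma_finite setT nu.
Proof.
have /sigma_finiteP[F [TF ndF Foo]] := sigma_finiteT (@lebesgue_measure R).
have /sigma_finiteP[G [TG ndG Goo]] := sigma_finiteT mu.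
exists (fun n => F n `*` G n).
  rewrite -setXTT TF TG predeqE => -[x y]; split.
    move=> [/= [i _ Fix] [j _ Gjy]]; exists (maxn i j) => //; split.
    - by move: x Fix; exact/subsetPset/ndF/leq_maxl.
    - by move: y Gjy; exact/subsetPset/ndG/leq_maxr.
  by move=> [i _ []/= ? ?]; split; exists i.
move=> k; have [? ?] := Foo k; have [? ?] := Goo k.
split; first exact: measurableX.
by rewrite /nu/= product_measure1E// lte_mul_pinfty// ge0_fin_numE.
Qed.

Let tcons (z : R1 * n.-tuple R) : n.+1.-tuple R := [tuple of z.1 :: z.2].

Let measurable_tcons : measurable_fun [set: R1 * n.-tuple R] tcons.
Proof. exact: measurable_cons. Qed.

Let tuncons (t : n.+1.-tuple R) : R1 * n.-tuple R :=
  (thead t, [tuple of behead t]).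

Let measurable_tuncons : measurable_fun [set: n.+1.-tuple R] tuncons.
Proof.
apply: measurable_fun_pair; first exact: measurable_tnth.
exact: measurable_behead.
Qed.

Let tconsK : cancel tcons tuncons.
Proof.
move=> [x t]; rewrite /tuncons /tcons /= theadE; congr pair.
exact: val_inj.
Qed.

Definition lebesgue_tuple_step : set (n.+1.-tuple R) -> \bar R :=
  pushforward (lebesgue_measure \x mu)%E
    (fun z : R1 * n.-tuple R => [tuple of z.1 :: z.2]).

HB.instance Definition _ := Measure.copy lebesgue_tuple_step
  (pushforward_measure nu measurable_tcons).

HB.instance Definition _ := Measure_isSigmaFinite.Build _ _ _
  lebesgue_tuple_step
  (sigma_finite_pushforward sigma_finite_nu measurable_tuncons tconsK).

End tuple_step.

Fixpoint lebesgue_tuple (n : nat) :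
    {sigma_finite_measure set (n.-tuple R) -> \bar R} :=
  match n with
  | 0 => \d_([tuple])
  | n'.+1 => lebesgue_tuple_step (lebesgue_tuple n')
  end.

Lemma lebesgue_tuple_box (n : nat) (A : 'I_n -> set R) :
  (forall i, measurable (A i)) ->
  lebesgue_tuple n [set t | forall i, A i (tnth t i)] =
  (\prod_(i < n) (@lebesgue_measure R (A i)))%E.
Proof.
elim: n A => [|n IH] A mA.
  rewrite big_ord0 /= diracE mem_set//; by case.
rewrite big_ord_recl /= /lebesgue_tuple_step /pushforward.
rewrite (_ : _ @^-1` _ =
    A ord0 `*` [set t | forall i, A (lift ord0 i) (tnth t i)]).
  rewrite product_measure1E//; last first.
    rewrite (_ : [set _ | _] = \big[setI/setT]_(i < n)
        ((fun t : n.-tuple R => tnth t i) @^-1` A (lift ord0 i))).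
      apply: big_ind => //; first exact: measurableI.
      by move=> i _; rewrite -[X in measurable X]setTI; exact: measurable_tnth.
    apply/seteqP; split => t /=; rewrite -bigcap_seq => h i.
      by move=> _ /=; exact: h.
    by apply: h; rewrite /= mem_index_enum.
  - exact: mA.
  - by congr (_ * _)%E; apply: (IH (fun i => A (lift ord0 i))) => i; exact: mA.
apply/seteqP; split=> -[x t] /=.
  move=> h; split; first exact: (h ord0).
  by move=> i; have := h (lift ord0 i); rewrite tnthS.
move=> [hx h] i; case: (unliftP ord0 i) => [j|] ->; last by [].
rewrite tnthS; exact: h.
Qed.

Section matrix_step.
Variables m n : nat.

Let tuple_mx (t : (m * n).-tuple R) : 'M[R]_(m, n) :=
  \matrix_(i, j) tnth t (mxvec_index i j).

Let measurable_tuple_mx : measurable_fun [set: (m * n).-tuple R] tuple_mx.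
Proof.
apply: measurable_fun_mx => i j; under eq_fun do rewrite mxE.
exact: measurable_tnth.
Qed.

Let mx_tuple (A : 'M[R]_(m, n)) : (m * n).-tuple R :=
  [tuple mxvec A ord0 k | k < m * n].

Let measurable_mx_tuple : measurable_fun [set: 'M[R]_(m, n)] mx_tuple.
Proof.
apply/measurable_fun_tnthP; case/mxvec_indexP => i j.
rewrite (_ : _ \o _ = fun A : 'M[R]_(m, n) => A i j).
  exact: measurable_mx_entry.
by apply/funext => A; rewrite /= tnth_mktuple mxvecE.
Qed.

Let tuple_mxK : cancel tuple_mx mx_tuple.
Proof.
move=> t; apply: eq_from_tnth; case/mxvec_indexP => i j.
by rewrite tnth_mktuple mxvecE mxE.
Qed.

Definition lebesgue_matrix : set 'M[R]_(m, n) -> \bar R :=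
  pushforward (lebesgue_tuple (m * n))
    (fun t => \matrix_(i, j) tnth t (mxvec_index i j)).

HB.instance Definition _ := Measure.copy lebesgue_matrix
  (pushforward_measure (lebesgue_tuple (m * n)) measurable_tuple_mx).

HB.instance Definition _ := Measure_isSigmaFinite.Build _ _ _ lebesgue_matrix
  (sigma_finite_pushforward (sigma_finiteT (lebesgue_tuple (m * n)))
     measurable_mx_tuple tuple_mxK).

Lemma lebesgue_matrix_box (A : 'I_m -> 'I_n -> set R) :
  (forall i j, measurable (A i j)) ->
  lebesgue_matrix [set y | forall i j, A i j (y i j)] =
  (\prod_(i < m) \prod_(j < n) lebesgue_measure (A i j))%E.
Proof.
move=> mA; pose B k :=
    let: (i, j) := enum_val (cast_ord (esym (mxvec_cast m n)) k)
    in A i j.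
have BE i j : B (mxvec_index i j) = A i j.
  by rewrite /B /mxvec_index cast_ordK enum_rankK.
have mB k : measurable (B k) by case/mxvec_indexP: k => i j; rewrite BE.
have -> : lebesgue_matrix [set y | forall i j, A i j (y i j)] =
    lebesgue_tuple (m * n) [set t | forall k, B k (tnth t k)].
  rewrite /lebesgue_matrix /pushforward.
  congr (SigmaFiniteMeasure.sort (lebesgue_tuple _) _).
  apply/seteqP; split => t /= h.
    by case/mxvec_indexP => i j; have := h i j; rewrite mxE BE.
  by move=> i j; have := h (mxvec_index i j); rewrite mxE BE.
rewrite lebesgue_tuple_box// pair_big /=.
rewrite (reindex _ (curry_mxvec_bij _ _)) /=.
by apply: eq_bigr => -[i j] _ /=; rewrite BE.
Qed.

End matrix_step.

End lebesgue_measure_matrix.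

Section surface_measure.
Context (R : realType) (n d : nat).
Implicit Type y : 'M[R]_(n, d).

(* Euclidean norm of R^(nd); the library's `|y| is the sup norm. *)
Definition enorm y : R := Num.sqrt (\sum_i \sum_j y i j ^+ 2).

Definition usphere : set 'M[R]_(n, d) := [set y | enorm y = 1].

Definition punctured_ball : set 'M[R]_(n, d) := [set y | 0 < enorm y <= 1].

Lemma measurable_enorm : measurable_fun [set: 'M[R]_(n, d)] enorm.
Proof.
apply: (measurableT_comp (f := @Num.sqrt R)).
  by apply: continuous_measurable_fun; exact: sqrt_continuous.
apply: measurable_sum => i; apply: measurable_sum => j.
by apply: measurable_funX; exact: measurable_mx_entry.
Qed.

Lemma measurable_punctured_ball : measurable punctured_ball.
Proof.
rewrite (_ : punctured_ball = enorm @^-1` `]0, 1]).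
  by rewrite -[X in measurable X]setTI; exact: measurable_enorm.
by apply/seteqP; split=> y /=; rewrite in_itv.
Qed.

Lemma measurable_usphere : measurable usphere.
Proof.
rewrite (_ : usphere = enorm @^-1` [set 1]).
  by rewrite -[X in measurable X]setTI; exact: measurable_enorm.
by apply/seteqP; split=> y.
Qed.

Let normalize y : 'M[R]_(n, d) := (enorm y)^-1 *: y.

Let measurable_normalize : measurable_fun [set: 'M[R]_(n, d)] normalize.
Proof.
apply: measurable_fun_mx => i j; under eq_fun do rewrite mxE.
apply: measurable_funM; last exact: measurable_mx_entry.
rewrite (_ : (fun _ => _) = fun y => enorm y `^ (-1)).
  apply: (measurableT_comp (f := @powR R ^~ (-1))).
    exact: measurable_powR.
  exact: measurable_enorm.
by apply/funext => y; rewrite powR_inv1// sqrtr_ge0.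
Qed.

(* sigma_(nd-1)(A) = nd * |{t w : w \in A, |w| = 1, 0 < t <= 1}|, the measure
   for which dy = t^(nd-1) dt dsigma(w) in polar coordinates y = t w. The cone
   over A is written as the set of y with 0 < |y| <= 1 and y / |y| \in A. *)
Definition surface_measure (A : set 'M[R]_(n, d)) : \bar R :=
  ((n * d)%:R%:E *
   lebesgue_matrix
     ((fun y => (enorm y)^-1 *: y) @^-1` A `&` punctured_ball))%E.

HB.instance Definition _ := Measure.copy surface_measure
  (mscale (n * d)%:R%:nng
    (pushforward_measure
      (mrestr (@lebesgue_matrix R n d) measurable_punctured_ball)
      measurable_normalize)).

Lemma surface_measure_sphere (A : set 'M[R]_(n, d)) :
  surface_measure (A `&` usphere) = surface_measure A.
Proof.
rewrite /surface_measure; congr (_ * lebesgue_matrix _)%E.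
apply/seteqP; split=> y /= [] => [[]//|Ay] yB; split=> //; split=> //.
rewrite /usphere /= /enorm.
have -> : \sum_i \sum_j ((enorm y)^-1 *: y) i j ^+ 2 =
    (enorm y ^+ 2)^-1 * (\sum_i \sum_j y i j ^+ 2).
  rewrite mulr_sumr; apply: eq_bigr => i _.
  rewrite mulr_sumr; apply: eq_bigr => j _.
  by rewrite mxE exprMn exprVn.
have y0 : 0 < enorm y by case/andP: yB.
have -> : \sum_i \sum_j y i j ^+ 2 = enorm y ^+ 2.
  rewrite sqr_sqrtr// sumr_ge0// => i _.
  by rewrite sumr_ge0// => j _; rewrite sqr_ge0.
by rewrite mulVf ?sqrtr1// expf_neq0// gt_eqF.
Qed.

End surface_measure.
Arguments usphere : clear implicits.

Section schwartz.
Context (R : realType) (d : nat).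
Implicit Type f : 'rV[R]_d -> R.

Definition partials (s : seq 'I_d) f : 'rV[R]_d -> R :=
  foldr (fun i g => 'D_(delta_mx ord0 i) g) f s.

(* 'D_v is a total operator, so existence of the derivatives is required
   separately. *)
Definition smooth f := forall s : seq 'I_d, continuous (partials s f) /\
  forall (i : 'I_d) x, derivable (partials s f) x (delta_mx ord0 i).

Definition schwartz f := smooth f /\
  forall (a : 'I_d -> nat) (s : seq 'I_d), exists M : R, forall x : 'rV[R]_d,
    `|(\prod_i x ord0 i ^+ a i) * partials s f x| <= M.

End schwartz.

Definition spherical_average (R : realType) (n d : nat)
    (f : 'I_n -> 'rV[R]_d -> R) (x : 'rV[R]_d) : \bar R :=
  (\int[@surface_measure R n d]_(y in usphere R n d)
     (\prod_(i < n) f i (x - row i y)%R)%:E)%E.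

(* Main.v *)
Require Import Defs.
From HB Require Import structures.
From mathcomp Require Import all_boot all_order all_algebra.
From mathcomp Require Import all_classical all_reals all_analysis.
From mathcomp Require Import measurable_realfun ess_sup_inf ring lra.

Set Implicit Arguments.
Unset Strict Implicit.
Unset Printing Implicit Defensive.

Import Order.TTheory GRing.Theory Num.Theory.
Import numFieldTopology.Exports numFieldNormedType.Exports.

Local Open Scope classical_set_scope.
Local Open Scope ring_scope.
Local Open Scope ereal_scope.

(** Everything is reduced to one local inequality, the only place where the
    geometry of the sphere S and the hypothesis d >= 2 matter.

    Geometry. If G >= 0 is a function on (R^d)^n and Q is the cube
    |x|_oo <= 1, then the integral over x in Q and y in S of
    G(x - y_1, ..., x - y_n) is at most a constant times the integral of G
    (cone_integral_le). Heuristically, for given z the points x such that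
    (x - z_1, ..., x - z_n) lies on S form a sphere of R^d of some radius
    rho, carrying a mass proportional to rho^(d-2), which is bounded for
    d >= 2. The proof needs only translations and dilations. The integral over
    S is an integral over 0 < |y| <= 1 of a function of y / |y|. Let u be in
    R^2, seen as a vector (u, 0) of R^d; translate y by the point with all
    rows equal to (u, 0), and translate x so as to cancel the effect on the
    argument of G. Then u survives only in
    tau = |y + ((u, 0), ..., (u, 0))|^2 = n |u + m(y)|^2 + q(y),
    and the plane integral of a function of such a quantity is bounded by its
    integral in tau, because the image of the plane Lebesgue measure by |u|^2
    is a multiple of dtau (ge0_integral_sqnorm). Once tau is a variable on its
    own, a dilation of y yields tau^(nd/2) times the integral of G, while x
    is confined to a cube of side 4 / sqrt tau; as n >= 1 and tau <= 1 the
    product tau^(nd/2) tau^(-d/2) is bounded.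

    Analysis. Put s = max(1, r). Jensen's inequality and the local inequality
    for the product of the f_i^s bound the integral of A^n(f)^r over c + Q by
    a constant times the product of the (int_(c + 2Q) f_i^s)^(r/s)
    (average_power_local). Since 1/p_i <= 1/r and p_i >= 1, also s <= p_i, so
    by Jensen again these factors are controlled by
    (int_(c + 2Q) f_i^(p_i))^(r/p_i) (local_norm). The exponents r/p_i add up
    to 1, so integrating in c and applying Hoelder's inequality for n
    functions (ge0_hoelder) gives the theorem for finite r. For infinite r all
    the p_i are infinite and A^n(f) is bounded pointwise by the product of the
    suprema of the f_i. *)

(** * Lebesgue measure on matrices: affine maps and products *)

Section lebesgue_matrix_theory.
Context (R : realType).
Implicit Types m n : nat.
Local Notation leb m n := (@lebesgue_matrix R m n).

Definition mxbox m n (A : 'I_m -> 'I_n -> set R) : set 'M[R]_(m, n) :=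
  [set y | forall i j, A i j (y i j)].

Lemma measurable_mxbox m n (A : 'I_m -> 'I_n -> set R) :
  (forall i j, measurable (A i j)) -> measurable (mxbox A).
Proof.
move=> mA; rewrite (_ : mxbox A = \big[setI/setT]_i \big[setI/setT]_j
    ((fun y : 'M[R]_(m, n) => y i j) @^-1` A i j)).
  apply: big_ind => [//||i _]; first exact: measurableI.
  apply: big_ind => [//||j _]; first exact: measurableI.
  by rewrite -[X in measurable X]setTI; exact: measurable_mx_entry.
apply/seteqP; split => y /=; rewrite -bigcap_seq => yA.
  by move=> i _ /=; rewrite -bigcap_seq => j _; exact: yA.
move=> i j; have /= := yA i; rewrite mem_index_enum => /(_ isT).
by rewrite -bigcap_seq => /(_ j); rewrite /= mem_index_enum => /(_ isT).
Qed.

Lemma lebesgue_matrix_mxbox m n (A : 'I_m -> 'I_n -> set R) :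
  (forall i j, measurable (A i j)) ->
  leb m n (mxbox A) = \prod_(i < m) \prod_(j < n) lebesgue_measure (A i j).
Proof. exact: lebesgue_matrix_box. Qed.

(** The boxes form a pi-system that generates the sigma-algebra and that
    contains an exhaustion by boxes of finite measure. All the invariance
    properties of the measure below are read off from boxes through this. *)
Lemma lebesgue_matrix_unique m n
    (mu : {measure set 'M[R]_(m, n) -> \bar R}) :
  (forall A, (forall i j, measurable (A i j)) -> mu (mxbox A) =
     \prod_(i < m) \prod_(j < n) lebesgue_measure (A i j)) ->
  forall B, measurable B -> lebesgue_matrix B = mu B.
Proof.
move=> muE B mB.
pose G := [set mxbox A | A in [set A : 'I_m -> 'I_n -> set R |
  forall i j, measurable (A i j)]].
pose g (k : nat) := mxbox (fun (_ : 'I_m) (_ : 'I_n) =>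
  `[(- k%:R)%R, k%:R]%classic : set R).
apply: (measure_unique G g) => //.
- apply/seteqP; split.
    apply: smallest_sub; first exact: smallest_sigma_algebra.
    move=> S; rewrite -bigcup_seq => -[k _ [D mD <-]].
    apply: sub_sigma_algebra; case/mxvec_indexP: k => i j.
    exists (fun i' j' => if (i' == i) && (j' == j) then D else setT).
      by move=> i' j'; case: ifP.
    rewrite setTI; apply/seteqP; split => y /=.
      move=> /(_ i j); rewrite !eqxx/=.
      by rewrite /mx_entry mxvecE.
    rewrite /mx_entry mxvecE => Dy i' j'.
    by case: ifP => // /andP[/eqP -> /eqP ->].
  apply: smallest_sub; first exact: sigma_algebra_measurable.
  by move=> _ [A mA <-]; exact: measurable_mxbox.
- move=> _ _ [A mA <-] [A' mA' <-].
  exists (fun i j => A i j `&` A' i j).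
    by move=> i j; apply: measurableI; [exact: mA|exact: mA'].
  apply/seteqP; split => y /=.
    by move=> h; split => i j; have [] := h i j.
  by move=> [h1 h2] i j; split; [exact: h1|exact: h2].
- by move=> k; exists (fun=> fun=> `[(- k%:R)%R, k%:R]%classic).
- rewrite -subTset => y _.
  pose M := (\sum_i \sum_j `|y i j|)%R.
  exists (Num.trunc M).+1 => //= i j.
  have yM : (`|y i j| <= M)%R.
    rewrite /M (bigD1 i)//= (bigD1 j)//= -addrA lerDl.
    by rewrite addr_ge0// sumr_ge0// => ? _; rewrite sumr_ge0.
  rewrite /= in_itv/= -ler_norml (le_trans yM)// ltW// truncnS_gt//.
- by move=> _ [A mA <-]; rewrite muE// -lebesgue_matrix_box.
- move=> k; rewrite [ltLHS]lebesgue_matrix_box// ltey_eq.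
  apply/orP; left.
  do 2 (apply: prode_fin_num => ? _).
  by rewrite lebesgue_measure_itv/=; case: ifP.
Qed.

Lemma lebesgue_measure_affine (a h : R) (A : set R) : a != 0%R ->
  measurable A ->
  lebesgue_measure A =
  `|a|%:E * lebesgue_measure ((fun x => a * x + h)%R @^-1` A).
Proof.
move=> a0 mA.
have mf : measurable_fun [set: measurableTypeR R]
    (fun x => (a * (x : R) + h)%R : measurableTypeR R).
  by apply: measurable_funD => //; exact: measurable_funM.
pose mu : {measure set (measurableTypeR R) -> \bar R} :=
  mscale (NngNum (normr_ge0 a))
  (pushforward_measure (@lebesgue_measure R) mf).
rewrite -[RHS]/(mu A).
apply: (@lebesgue_measure_unique R mu _ A mA) => X [[u v] _ <-].
rewrite /mu/= /mscale/= /pushforward/=.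
have [ap|an|] := ltgtP 0%R a; last by move/eqP; rewrite eq_sym (negbTE a0).
  rewrite (_ : _ @^-1` _ = `](u - h) / a, (v - h) / a]%classic)%R; last first.
    apply/seteqP; split => x /=; rewrite !in_itv/= ltr_pdivrMr// ler_pdivlMr//.
      by rewrite ltrBlDr lerBrDr [(x * a)%R]mulrC.
    by rewrite ltrBlDr lerBrDr [(x * a)%R]mulrC.
  rewrite !lebesgue_measure_itv/= !lte_fin ltr_pM2r ?invr_gt0// ltrD2r.
  case: ifPn => _; last by rewrite mule0.
  by rewrite -!EFinB -EFinM gtr0_norm//; congr EFin; field.
rewrite (_ : _ @^-1` _ = `[(v - h) / a, (u - h) / a[%classic)%R; last first.
  apply/seteqP; split => x /=; rewrite !in_itv/= ler_ndivrMr// ltr_ndivlMr//.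
    by rewrite ltrBlDr lerBrDr [(x * a)%R]mulrC andbC.
  by rewrite ltrBlDr lerBrDr [(x * a)%R]mulrC andbC.
rewrite !lebesgue_measure_itv/= !lte_fin ltr_nM2r ?invr_lt0// ltrD2r.
case: ifPn => _; last by rewrite mule0.
by rewrite -!EFinB -EFinM ltr0_norm//; congr EFin; field.
Qed.

Lemma measurable_affine_mx m n (a : R) (h : 'M[R]_(m, n)) :
  measurable_fun [set: 'M[R]_(m, n)] (fun y => a *: y + h)%R.
Proof.
apply: measurable_fun_mx => i j; under eq_fun do rewrite !mxE.
apply: measurable_funD => //; apply: measurable_funM => //.
exact: measurable_mx_entry.
Qed.

Lemma ge0_integral_affine_mx m n (a : R) (h : 'M[R]_(m, n))
    (G : 'M[R]_(m, n) -> \bar R) :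
  a != 0%R -> measurable_fun setT G -> (forall y, 0 <= G y) ->
  \int[leb m n]_y G y =
  (`|a| ^+ (m * n))%:E * \int[leb m n]_y G (a *: y + h)%R.
Proof.
move=> a0 mG G0.
have ge0a : (0 <= `|a| ^+ (m * n))%R by rewrite exprn_ge0.
pose mu := mscale (NngNum ge0a)
  (pushforward_measure (@lebesgue_matrix R m n) (measurable_affine_mx a h)).
rewrite (eq_measure_integral mu) => [|A mA _].
  by rewrite ge0_integral_mscale//= ge0_integral_pushforward//;
     exact: measurable_affine_mx.
apply: lebesgue_matrix_unique mA => {}A mA.
rewrite /mu/= /mscale/= /pushforward/=.
rewrite (_ : _ @^-1` _ =
   mxbox (fun i j => (fun x => a * x + h i j)%R @^-1` A i j)); last first.
  by apply/seteqP; split => y /= yA i j; have := yA i j; rewrite !mxE.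
rewrite lebesgue_matrix_box; last first.
  move=> i j; rewrite -[X in measurable X]setTI.
  have : measurable_fun [set: R] (fun x : R => a * x + h i j)%R.
    by apply: measurable_funD => //; exact: measurable_funM.
  by apply.
transitivity (\prod_(i < m) \prod_(j < n) (`|a|%:E *
    lebesgue_measure ((fun x => a * x + h i j)%R @^-1` A i j))).
  rewrite [in RHS]pair_big/= [in LHS]pair_big/= big_split/=; congr (_ * _).
  by rewrite prodEFin prodr_const card_prod !card_ord.
by apply: eq_bigr => i _; apply: eq_bigr => j _;
  rewrite -lebesgue_measure_affine.
Qed.

Lemma ge0_integral_translate_mx m n (h : 'M[R]_(m, n))
    (G : 'M[R]_(m, n) -> \bar R) :
  measurable_fun setT G -> (forall y, 0 <= G y) ->
  \int[leb m n]_y G (y + h)%R = \int[leb m n]_y G y.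
Proof.
move=> mG G0; rewrite [RHS](ge0_integral_affine_mx h (oner_neq0 R))//.
rewrite normr1 expr1n mul1e.
by apply: eq_integral => y _; rewrite scale1r.
Qed.

(** Splitting off the first row identifies R^d x (R^d)^n with (R^d)^(n+1);
    1 + n is convertible to n.+1, which spares a cast. *)
Definition mxcons n d (z : 'rV[R]_d * 'M[R]_(n, d)) : 'M[R]_(n.+1, d) :=
  @col_mx R 1 n d z.1 z.2.

Lemma mxcons_head n d z k j : @mxcons n d z (@lshift 1 n k) j = z.1 k j.
Proof. exact: (@col_mxEu R 1). Qed.

Lemma mxcons_tail n d z k j : @mxcons n d z (@rshift 1 n k) j = z.2 k j.
Proof. exact: (@col_mxEd R 1). Qed.

Lemma measurable_mxcons n d : measurable_fun setT (@mxcons n d).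
Proof.
apply: measurable_fun_mx => i j; rewrite /mxcons.
case: (@split_ordP 1 n i) => k ->.
  under eq_fun do rewrite mxcons_head.
  apply: (measurableT_comp (f := fun y : 'rV[R]_d => y k j)) => //.
  exact: measurable_mx_entry.
under eq_fun do rewrite mxcons_tail.
apply: (measurableT_comp (f := fun y : 'M[R]_(n, d) => y k j)) => //.
exact: measurable_mx_entry.
Qed.

Lemma ge0_integral_mxcons n d (G : 'M[R]_(n.+1, d) -> \bar R) :
  measurable_fun setT G -> (forall y, 0 <= G y) ->
  \int[leb n.+1 d]_y G y =
  \int[leb 1 d]_x \int[leb n d]_y G (mxcons (x, y)).
Proof.
move=> mG G0.
have := @fubini_tonelli1 _ _ _ _ R (@lebesgue_matrix R 1 d)
  (@lebesgue_matrix R n d)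
  (G \o @mxcons n d).
rewrite /fubini_F /= => <- //; last first.
  by apply: measurableT_comp => //; exact: measurable_mxcons.
pose mu := pushforward_measure
  (@lebesgue_matrix R 1 d \x @lebesgue_matrix R n d) (@measurable_mxcons n d).
rewrite (eq_measure_integral mu) => [|A mA _].
  by rewrite ge0_integral_pushforward//; exact: measurable_mxcons.
apply: lebesgue_matrix_unique mA => {}A mA.
rewrite /mu/= /pushforward/=.
rewrite (_ : _ @^-1` _ = mxbox (fun i : 'I_1 => A (lshift n i)) `*`
    mxbox (fun i : 'I_n => A (rshift 1 i))).
  rewrite product_measure1E; [|exact: measurable_mxbox..].
  rewrite /= [X in X * _]lebesgue_matrix_mxbox//
    [X in _ * X]lebesgue_matrix_mxbox//.
  by rewrite [RHS](@big_split_ord _ _ _ 1 n).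
apply/seteqP; split => -[x y] /=.
  move=> h; split => i j.
    by have := h (lshift n i) j; rewrite mxcons_head.
  by have := h (rshift 1 i) j; rewrite mxcons_tail.
move=> [hx hy] i j; case: (@split_ordP 1 n i) => k ->.
  by rewrite mxcons_head; exact: hx.
by rewrite mxcons_tail; exact: hy.
Qed.

Lemma measurable_row m n (i : 'I_m) :
  measurable_fun setT (fun y : 'M[R]_(m, n) => row i y).
Proof.
apply: measurable_fun_mx => k j; under eq_fun do rewrite mxE.
exact: measurable_mx_entry.
Qed.

Lemma emeasurable_prod_fun d0 (T : measurableType d0) (I : Type) (s : seq I)
    (P : pred I) (D : set T) (g : I -> T -> \bar R) :
  (forall i, measurable_fun D (g i)) ->
  measurable_fun D (fun x => \prod_(i <- s | P i) g i x).
Proof.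
move=> mg; elim: s => [|i s IH].
  rewrite (_ : (fun _ => _) = cst 1); first exact: measurable_cst.
  by apply/funext => x; rewrite big_nil.
rewrite (_ : (fun _ => _) = fun x => if P i
    then g i x * \prod_(j <- s | P j) g j x else \prod_(j <- s | P j) g j x).
  by case: (P i) => //; exact: emeasurable_funM.
by apply/funext => x; rewrite big_cons.
Qed.

(** Tonelli's theorem, one row at a time. *)
Lemma ge0_integral_prod_row n d (g : 'I_n -> 'rV[R]_d -> \bar R) :
  (forall i, measurable_fun setT (g i)) -> (forall i x, 0 <= g i x) ->
  \int[leb n d]_y (\prod_(i < n) g i (row i y)) =
  \prod_(i < n) \int[leb 1 d]_x g i x.
Proof.
elim: n g => [|n IH] g mg g0.
  under eq_integral do rewrite big_ord0.
  rewrite integral_cst// mul1e big_ord0 (_ : setT = mxbox (fun=> fun=> setT)).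
    by rewrite [LHS]lebesgue_matrix_mxbox// big_ord0.
  by apply/seteqP; split => y.
rewrite ge0_integral_mxcons; last 2 first.
  apply: emeasurable_prod_fun => i.
  by apply: measurableT_comp => //; exact: measurable_row.
  by move=> y; exact: prode_ge0.
have rowE (x : 'rV[R]_d) (y : 'M[R]_(n, d)) :
    \prod_(i < n.+1) g i (row i (mxcons (x, y))) =
    g ord0 x * \prod_(i < n) g (lift ord0 i) (row i y).
  rewrite big_ord_recl; congr (g _ _ * _).
    apply/rowP => j; rewrite mxE -[RHS](mxcons_head (x, y)).
    by congr (fun_of_matrix _ _ _); exact: val_inj.
  apply: eq_bigr => i _; congr (g _ _).
  apply/rowP => j; rewrite [LHS]mxE [RHS]mxE -[RHS](mxcons_tail (x, y)).
  by congr (fun_of_matrix _ _ _); exact: val_inj.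
under eq_integral => x _.
  under eq_integral => y _ do rewrite rowE.
  rewrite ge0_integralZl//; last 2 first.
    apply: emeasurable_prod_fun => i.
    by apply: measurableT_comp => //; exact: measurable_row.
    by move=> y _; exact: prode_ge0.
  over.
rewrite ge0_integralZr//; last first.
  by apply: integral_ge0 => y _; exact: prode_ge0.
by rewrite (IH (fun i => g (lift ord0 i)))// [RHS]big_ord_recl.
Qed.

End lebesgue_matrix_theory.

(** * Open sets, continuous functions and cubes *)

Section borel_matrix.
Context (R : realType).
Implicit Types m n : nat.
Local Notation leb m n := (@lebesgue_matrix R m n).

Lemma ball_mxbox m n (x : 'M[R]_(m, n)) (e : R) : (0 < e)%R ->
  ball x e = mxbox (fun i j => `](x i j - e)%R, (x i j + e)%R[%classic).
Proof.
move=> e0; apply/seteqP; split => y /=.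
  by move=> [_ +] i j => /(_ i j); rewrite /ball/= in_itv/= ltr_distlC.
move=> xy; split=> // i j.
by rewrite /ball/= ltr_distlC; have := xy i j; rewrite /= in_itv.
Qed.

(** The balls of the sup norm are boxes, and an open set is the union of the
    balls with rational centre and radius 1/(k+1) that it contains. *)
Lemma open_measurable_mx m n (U : set 'M[R]_(m, n)) : open U -> measurable U.
Proof.
move=> oU.
pose B (q : 'M[rat]_(m, n) * nat) : set 'M[R]_(m, n) :=
  if pselect (ball (map_mx ratr q.1 : 'M[R]_(m, n)) q.2.+1%:R^-1%R `<=` U)
  then ball (map_mx ratr q.1 : 'M[R]_(m, n)) q.2.+1%:R^-1%R else set0.
rewrite (_ : U = \bigcup_q B q).
  apply: countable_bigcupT_measurable => // q; rewrite /B.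
  case: pselect => [?|?] /=; last exact: measurable0.
  rewrite ball_mxbox ?invr_gt0 //.
  exact: measurable_mxbox.
apply/seteqP; split => x; last first.
  by move=> [q _]; rewrite /B; case: pselect => // qU; exact: qU.
move=> Ux; move: (oU) => /(_ x Ux)/nbhs_ballP[e /= e0 xeU].
have [k ke] : exists k : nat, (k.+1%:R^-1 < e / 2 :> R)%R.
  exists (Num.trunc (e / 2)^-1).
  by rewrite invf_plt ?posrE ?divr_gt0// truncnS_gt.
have [q qx] : {q : 'I_m * 'I_n -> rat & forall ij, ratr (q ij) \in
    `](x ij.1 ij.2 - k.+1%:R^-1)%R, (x ij.1 ij.2 + k.+1%:R^-1)%R[}.
  apply: (@choice _ _ (fun ij q => ratr q \in
    `](x ij.1 ij.2 - k.+1%:R^-1)%R, (x ij.1 ij.2 + k.+1%:R^-1)%R[)).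
  move=> -[i j]; apply: rat_in_itvoo.
  by rewrite ltrD2l gtrN// invr_gt0.
have qball : ball (map_mx ratr (\matrix_(i, j) q (i, j)) : 'M[R]_(m, n))
    k.+1%:R^-1%R x.
  rewrite ball_mxbox ?invr_gt0// => i j /=; have := qx (i, j).
  rewrite !mxE !in_itv/= => /andP[? ?].
  by rewrite ltrBlDr -[in X in _ && X]ltrBlDr; apply/andP.
exists (\matrix_(i, j) q (i, j), k) => //; rewrite /B.
case: pselect => //= -[] y qy; apply: xeU.
apply: (@le_ball _ _ _ (k.+1%:R^-1 + k.+1%:R^-1)%R);
  first by rewrite [leRHS](splitr e) lerD // ltW.
apply: ball_triangle qy; exact: ball_sym.
Qed.

Lemma continuous_measurable_mx m n (f : 'M[R]_(m, n) -> R) :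
  continuous f -> measurable_fun [set: 'M[R]_(m, n)] f.
Proof.
move=> /continuousP cf.
apply: (measurability _ (RGenOpens.measurableE R)).
move=> _ [_ [a [b ->]] <-]; rewrite setTI; apply: open_measurable_mx.
by apply: cf; exact: interval_open.
Qed.

Lemma lebesgue_matrix_open_gt0 m n (U : set 'M[R]_(m, n)) x :
  open U -> U x -> 0 < leb m n U.
Proof.
move=> oU Ux; move: (oU) => /(_ x Ux)/nbhs_ballP[e /= e0 xeU].
apply: (@lt_le_trans _ _ (leb m n (ball x e))); last first.
  apply: le_measure => //; rewrite inE.
    rewrite ball_mxbox//; exact: measurable_mxbox.
  exact: open_measurable_mx.
rewrite ball_mxbox// [ltRHS]lebesgue_matrix_mxbox//.
rewrite (eq_bigr (fun=> \prod_(j < n) (2 * e)%:E)) => [|i _].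
  rewrite prodEFin prodEFin lte_fin.
  by apply: prodr_gt0 => i _; apply: prodr_gt0 => j _; lra.
apply: eq_bigr => j _; rewrite lebesgue_measure_itv/= lte_fin ifT; last lra.
by rewrite -EFinB; congr EFin; lra.
Qed.

Definition cube m n (a : R) : set 'M[R]_(m, n) :=
  [set x | forall i j, `|x i j| <= a]%R.

Lemma cube_mxbox m n (a : R) :
  @cube m n a = mxbox (fun _ _ => `[- a, a]%classic)%R.
Proof.
by apply/seteqP; split => x /= xa i j; have := xa i j;
  rewrite /= in_itv/= ler_norml.
Qed.

Lemma measurable_cube m n (a : R) : measurable (@cube m n a).
Proof. by rewrite cube_mxbox; exact: measurable_mxbox. Qed.

Lemma lebesgue_cube m n (a : R) : (0 <= a)%R ->
  leb m n (@cube m n a) = ((2 * a) ^+ (m * n))%:E.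
Proof.
move=> a0; rewrite cube_mxbox [LHS]lebesgue_matrix_mxbox//.
rewrite (eq_bigr (fun=> \prod_(j < n) (2 * a)%:E)) => [|i _].
  rewrite prodEFin prodEFin prodr_const prodr_const -exprM.
  by rewrite !card_ord mulnC.
apply: eq_bigr => j _; rewrite lebesgue_measure_itv/= lte_fin.
case: ltP => [_|?]; first by rewrite -EFinB; congr EFin; lra.
by congr EFin; lra.
Qed.

End borel_matrix.

(** * Radial integration in the plane *)

Section radial.
Context (R : realType).
Local Notation leb m n := (@lebesgue_matrix R m n).

Lemma ge0_integral_affine (a h : R) (G : R -> \bar R) : a != 0%R ->
  measurable_fun [set: R] G -> (forall x, 0 <= G x) ->
  \int[lebesgue_measure]_x G x =
  `|a|%:E * \int[lebesgue_measure]_x G (a * x + h)%R.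
Proof.
move=> a0 mG G0.
have mf : measurable_fun [set: measurableTypeR R]
    (fun x => (a * (x : R) + h)%R : measurableTypeR R).
  by apply: measurable_funD => //; exact: measurable_funM.
pose mu : {measure set (measurableTypeR R) -> \bar R} :=
  mscale (NngNum (normr_ge0 a)) (pushforward_measure (@lebesgue_measure R) mf).
rewrite (eq_measure_integral mu) => [|A mA _].
  by rewrite ge0_integral_mscale//= ge0_integral_pushforward.
rewrite /mu/= /mscale/= /pushforward/=.
exact: lebesgue_measure_affine.
Qed.

Definition sqnorm (u : 'rV[R]_2) : R := (\sum_(j < 2) u ord0 j ^+ 2)%R.

Lemma sqnorm_ge0 u : (0 <= sqnorm u)%R.
Proof. by apply: sumr_ge0 => j _; exact: sqr_ge0. Qed.

Lemma measurable_sqnorm : measurable_fun [set: 'rV[R]_2]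
  (sqnorm : 'rV[R]_2 -> measurableTypeR R).
Proof.
apply: measurable_sum => j; apply: measurable_funX.
exact: measurable_mx_entry.
Qed.

Definition disc (t : R) : set 'rV[R]_2 := [set u | sqnorm u <= t]%R.

Lemma measurable_disc t : measurable (disc t).
Proof.
rewrite (_ : disc t = sqnorm @^-1` `]-oo, t]).
  by rewrite -[X in measurable X]setTI; exact: measurable_sqnorm.
by apply/seteqP; split=> y /=; rewrite in_itv.
Qed.

(** Comparison with two squares, one inside the disc and one around it. *)
Lemma disc1_bounds : 1 <= leb 1 2 (disc 1) <= 4%:E.
Proof.
apply/andP; split.
  have -> : 1 = leb 1 2 (cube 2^-1) :> \bar R.
    by rewrite [RHS]lebesgue_cube// mulfV// expr1n.
  apply: le_measure; rewrite ?inE//;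
    [exact: measurable_cube|exact: measurable_disc|].
  move=> u /= uc; rewrite /disc/= /sqnorm !big_ord_recl big_ord0 addr0.
  have sq j : (u ord0 j ^+ 2 <= 2^-1 ^+ 2)%R.
    by rewrite -[leLHS]real_normK ?num_real// lerXn2r ?nnegrE.
  apply: (le_trans (lerD (sq _) (sq _))); lra.
have -> : 4%:E = leb 1 2 (cube 1).
  by rewrite [RHS]lebesgue_cube//; congr EFin; lra.
apply: le_measure; rewrite ?inE//;
  [exact: measurable_disc|exact: measurable_cube|].
move=> u /= uc i j; rewrite ord1 -(@ler_pXn2r _ 2) ?nnegrE//.
rewrite real_normK ?num_real// expr1n; apply: le_trans uc.
by rewrite /sqnorm (bigD1 j)//= lerDl sumr_ge0// => k _; rewrite sqr_ge0.
Qed.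

(** disc t is the disc of radius sqrt t, a dilate of the unit disc; it is
    empty for t < 0, hence the maximum. *)
Lemma lebesgue_disc t :
  leb 1 2 (disc t) = (Num.max t 0)%:E * leb 1 2 (disc 1).
Proof.
case: (ltgtP t 0%R) => [t0|t0|->].
- rewrite mul0e (_ : disc t = set0) ?measure0//.
  by apply/seteqP; split => // u /=;
    rewrite /disc/= leNgt (lt_le_trans t0)// sqnorm_ge0.
- have a0 : ((Num.sqrt t)^-1 != 0)%R by rewrite invr_eq0 sqrtr_eq0 -ltNge.
  have : \int[leb 1 2]_u (\1_(disc 1) u)%:E =
    t^-1%:E * \int[leb 1 2]_u (\1_(disc t) u)%:E.
    rewrite (ge0_integral_affine_mx 0 a0)//; last first.
      by apply/measurable_EFinP; apply: measurable_indic;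
        exact: measurable_disc.
    rewrite mul1n gtr0_norm ?invr_gt0 ?sqrtr_gt0// exprVn sqr_sqrtr ?ltW//.
    congr (_ * _); apply: eq_integral => u _.
    rewrite !indicE addr0; congr ((_ : bool)%:R%:E)%R.
    apply/idP/idP; rewrite !inE /disc/= /sqnorm.
      under eq_bigr do rewrite mxE exprMn exprVn sqr_sqrtr ?ltW//.
      by rewrite -mulr_sumr mulrC ler_pdivrMr// mul1r.
    move=> ut; under eq_bigr do rewrite mxE exprMn exprVn sqr_sqrtr ?ltW//.
    by rewrite -mulr_sumr mulrC ler_pdivrMr// mul1r.
  do 2 (rewrite integral_indic; [|exact: measurableT|exact: measurable_disc]).
  rewrite !setIT => ->; rewrite muleA -EFinM mulfV ?mul1e//; lra.
- rewrite mul0e (_ : disc 0 = mxbox (fun=> fun=> [set 0%R])).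
    by rewrite [LHS]lebesgue_matrix_mxbox// big_ord1 big_ord_recl
      lebesgue_measure_set1 mul0e.
  apply/seteqP; split => u /=; rewrite /disc/= /sqnorm.
    move=> u0 i j; rewrite ord1; apply/eqP; rewrite -sqrf_eq0.
    rewrite eq_le sqr_ge0 andbT; apply: le_trans u0.
    by rewrite (bigD1 j)//= lerDl sumr_ge0// => k _; rewrite sqr_ge0.
  by move=> u0; rewrite big1// => j _; rewrite u0 expr0n.
Qed.

(** The area of the annulus a < |u|^2 <= b is proportional to b - a, so the
    image of the plane measure by |u|^2 is k times the Lebesgue measure on the
    half-line t > 0, where k is the area of the unit disc. This is what makes
    two dimensions special: in dimension d the density is of order
    t^(d/2 - 1). *)
Lemma ge0_integral_sqnorm (phi : R -> \bar R) :
  measurable_fun [set: R] phi -> (forall t, 0 <= phi t) ->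
  \int[leb 1 2]_u phi (sqnorm u) <= 4%:E * \int[lebesgue_measure]_t phi t.
Proof.
move=> mphi phi0.
have /andP[k1 k4] := disc1_bounds.
have kE : leb 1 2 (disc 1) = (fine (leb 1 2 (disc 1)))%:E.
  by rewrite fineK// ge0_fin_numE// (le_lt_trans k4)// ltry.
set k := fine _ in kE; rewrite kE !lee_fin in k1 k4.
have k0 : (0 <= k)%R by lra.
have kn0 : (k != 0)%R by rewrite gt_eqF// (lt_le_trans ltr01).
have ki0 : (0 <= k^-1)%R by rewrite invr_ge0.
have mneg : measurable (`]-oo, 0%R] : set (measurableTypeR R)) by [].
(* Adding k times the Lebesgue measure on t <= 0 turns the image measure into
   a multiple of the Lebesgue measure on the whole line, so that its
   uniqueness applies. *)
pose nu := pushforward_measure (leb 1 2) measurable_sqnorm.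
pose m2 := mscale (NngNum k0) (mrestr (@lebesgue_measure R) mneg).
pose mu : {measure set (measurableTypeR R) -> \bar R} :=
  mscale (NngNum ki0) (measure_add nu m2).
have muE A : measurable A -> lebesgue_measure A = mu A.
  apply: lebesgue_measure_unique => {}A [[a b] _ <-].
  rewrite -[RHS]/(k^-1%:E * measure_add nu m2 _) measure_addE /= /m2 /mscale /=.
  rewrite /nu /= /pushforward /mrestr /=.
  rewrite (_ : `]a, b] `&` `]-oo, 0%R] = `]a, Num.min b 0%R]%classic);
    last first.
    apply/seteqP; split => x /=; rewrite !in_itv/= le_min.
      by move=> [/andP[-> ->] ->].
    by move=> /and3P[-> -> ->].
  rewrite (_ : sqnorm @^-1` _ = disc b `\` disc a); last first.
    apply/seteqP; split => u /=; rewrite in_itv/= /disc/=.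
      by move=> /andP[au ub]; split=> //; apply/negP; rewrite -ltNge.
    by move=> [-> /negP]; rewrite -ltNge => ->.
  have [ab|ba] := ltP a b; last first.
    rewrite (_ : disc b `\` disc a = set0) ?measure0; last first.
      by apply/seteqP; split => // u [/= ub] []; exact: le_trans ba.
    rewrite !lebesgue_measure_itv/= !lte_fin lt_min !ltNge ba/=.
    by rewrite mule0 add0e mule0.
  rewrite measureD; [|exact: measurable_disc..|]; last first.
    by rewrite [ltLHS]lebesgue_disc kE -EFinM ltry.
  rewrite setIidr; last by move=> u /= ua; exact: le_trans (ltW ab).
  rewrite [X in X - _](lebesgue_disc b) [X in _ - X](lebesgue_disc a).
  rewrite kE -!EFinM -EFinB.
  rewrite !lebesgue_measure_itv/= !lte_fin lt_min ab/=.
  have [a0|a0] := ltP a 0%R.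
    rewrite -!(EFinD, EFinM); congr EFin.
    by case: (ltP b 0%R) => b0; field.
  rewrite max_l ?(le_trans a0 (ltW ab))// mule0 adde0 -!(EFinD, EFinM).
  by congr EFin; field.
rewrite [X in _ * X](eq_measure_integral mu) => [|A mA _]; last exact: muE.
rewrite ge0_integral_mscale//= ge0_integral_measure_add//=.
rewrite (ge0_integral_pushforward measurable_sqnorm)//=.
rewrite muleA -EFinM ge0_muleDr; [|by apply: integral_ge0 => ? _..].
apply: (le_trans _ (leeDl _ _)); last first.
  by rewrite mule_ge0// ?lee_fin ?mulr_ge0//; apply: integral_ge0 => ? _.
rewrite -[leLHS]mul1e lee_pmul//; first by apply: integral_ge0 => ? _.
rewrite lee_fin ler_pdivlMr; lra.
Qed.

(** The form in which the radial bound is used: n |u + m|^2 + q is the squared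
    norm of a point of (R^d)^n moving in a plane (enorm_add_plane), and the
    constant is uniform in m and q. *)
Lemma ge0_integral_sqnorm_affine (n : nat) (m : 'rV[R]_2) (q : R)
    (phi : R -> \bar R) : (0 < n)%N ->
  measurable_fun [set: R] phi -> (forall t, 0 <= phi t) ->
  \int[leb 1 2]_u phi (n%:R * sqnorm (u + m) + q)%R <=
  4%:E * \int[lebesgue_measure]_t phi t.
Proof.
move=> n0 mphi phi0.
have mphi' : measurable_fun [set: R] (fun t : R => phi (n%:R * t + q)%R).
  apply: measurableT_comp => //.
  by apply: measurable_funD => //; exact: measurable_funM.
rewrite (ge0_integral_translate_mx m
  (G := fun u => phi (n%:R * sqnorm u + q)%R))//; last first.
  by apply: (measurableT_comp mphi'); exact: measurable_sqnorm.
apply: (le_trans (ge0_integral_sqnorm mphi' _)) => //.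
have nN0 : (n%:R : R) != 0%R by rewrite pnatr_eq0 -lt0n.
rewrite [in leRHS](ge0_integral_affine q nN0)// lee_pmul//.
  by apply: integral_ge0 => ? _.
rewrite -[leLHS]mul1e lee_pmul//; first by apply: integral_ge0 => ? _.
by rewrite lee_fin normr_nat ler1n.
Qed.

End radial.

(** * Diagonal translations and the Euclidean norm *)

Section measurable_matrix_ops.
Context d0 (T : measurableType d0) (R : realType) (m n : nat).

Lemma measurable_fun_entry (f : T -> 'M[R]_(m, n)) i j :
  measurable_fun setT f -> measurable_fun setT (fun t => f t i j).
Proof.
move=> mf; apply: (measurableT_comp (f := fun y : 'M[R]_(m, n) => y i j)) => //.
exact: measurable_mx_entry.
Qed.

Lemma measurable_fun_scalemx (a : T -> R) (f : T -> 'M[R]_(m, n)) :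
  measurable_fun setT a -> measurable_fun setT f ->
  measurable_fun setT (fun t => a t *: f t)%R.
Proof.
move=> ma mf; apply: measurable_fun_mx => i j; under eq_fun do rewrite mxE.
by apply: measurable_funM => //; exact: measurable_fun_entry.
Qed.

Lemma measurable_fun_addmx (f g : T -> 'M[R]_(m, n)) :
  measurable_fun setT f -> measurable_fun setT g ->
  measurable_fun setT (fun t => f t + g t)%R.
Proof.
move=> mf mg; apply: measurable_fun_mx => i j; under eq_fun do rewrite mxE.
by apply: measurable_funD => //; exact: measurable_fun_entry.
Qed.

Lemma measurable_fun_submx (f g : T -> 'M[R]_(m, n)) :
  measurable_fun setT f -> measurable_fun setT g ->
  measurable_fun setT (fun t => f t - g t)%R.
Proof.
move=> mf mg; apply: measurable_fun_mx => i j; under eq_fun do rewrite !mxE.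
by apply: measurable_funB => //; exact: measurable_fun_entry.
Qed.

Lemma measurable_fun_inv (f : T -> R) : (forall t, 0 <= f t)%R ->
  measurable_fun setT f -> measurable_fun setT (fun t => (f t)^-1)%R.
Proof.
move=> f0 mf.
rewrite (_ : (fun _ => _) = fun t => (f t `^ (-1))%R).
  by apply: (measurableT_comp (f := @powR R ^~ (-1)%R)) => //;
    exact: measurable_powR.
by apply/funext => t; rewrite powR_inv1.
Qed.

Lemma measurable_fun_sqrt (f : T -> R) :
  measurable_fun setT f -> measurable_fun setT (fun t => Num.sqrt (f t)).
Proof.
apply: (measurableT_comp (f := @Num.sqrt R)).
by apply: continuous_measurable_fun; exact: sqrt_continuous.
Qed.

End measurable_matrix_ops.

Section diagonal.
Context (R : realType) (n d : nat).

Definition diag_rows (x : 'rV[R]_d) : 'M[R]_(n, d) :=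
  (\matrix_(i, j) x ord0 j)%R.

Lemma diag_rowsD x y : diag_rows (x + y) = (diag_rows x + diag_rows y)%R.
Proof. by apply/matrixP => i j; rewrite !mxE. Qed.

Lemma diag_rowsZ a x : diag_rows (a *: x) = (a *: diag_rows x)%R.
Proof. by apply/matrixP => i j; rewrite !mxE. Qed.

Lemma measurable_diag_rows : measurable_fun setT diag_rows.
Proof.
apply: measurable_fun_mx => i j; under eq_fun do rewrite mxE.
exact: measurable_mx_entry.
Qed.

End diagonal.
Arguments diag_rows {R} n {d} x.

Section enorm.
Context (R : realType) (n d : nat).

Lemma enorm_ge0 (y : 'M[R]_(n, d)) : (0 <= enorm y)%R.
Proof. exact: sqrtr_ge0. Qed.

Lemma enorm_sqr (y : 'M[R]_(n, d)) :
  (enorm y ^+ 2 = \sum_i \sum_j y i j ^+ 2)%R.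
Proof.
rewrite sqr_sqrtr// sumr_ge0// => i _.
by rewrite sumr_ge0// => j _; rewrite sqr_ge0.
Qed.

End enorm.

Section plane.
Context (R : realType) (n d : nat).

Definition plane (u : 'rV[R]_2) : 'rV[R]_(d.+2) := @row_mx R 1 2 d u 0%R.

Lemma plane_lshift u k : plane u ord0 (@lshift 2 d k) = u ord0 k.
Proof. exact: (@row_mxEl R 1 2 d). Qed.

Lemma plane_rshift u k : plane u ord0 (@rshift 2 d k) = 0%R.
Proof. by rewrite [LHS](@row_mxEr R 1 2 d) mxE. Qed.

Lemma measurable_plane : measurable_fun setT plane.
Proof.
apply: measurable_fun_mx => i j; rewrite ord1.
case: (@split_ordP 2 d j) => k ->.
  by under eq_fun do rewrite plane_lshift; exact: measurable_mx_entry.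
by under eq_fun do rewrite plane_rshift; exact: measurable_cst.
Qed.

(** Completing the square in each of the first two columns: m averages the rows
    of y in these columns, and q is the squared distance from 0 to the plane
    through y. *)
Lemma enorm_add_plane (y : 'M[R]_(n, d.+2)) : (0 < n)%N ->
  exists m q, forall u, (enorm (y + diag_rows n (plane u)) ^+ 2 =
    n%:R * sqnorm (u + m) + q)%R.
Proof.
move=> n0.
have nN0 : (n%:R : R) != 0%R by rewrite pnatr_eq0 -lt0n.
pose m : 'rV[R]_2 := (\row_j (n%:R^-1 * \sum_i y i (@lshift 2 d j)))%R.
exists m, (enorm y ^+ 2 - n%:R * sqnorm m)%R => u.
rewrite !enorm_sqr exchange_big/= [in RHS]exchange_big/=.
rewrite [LHS](@big_split_ord _ _ _ 2 d)
  [X in (_ + (X - _))%R](@big_split_ord _ _ _ 2 d)/=.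
set S := (\sum_(j < d) \sum_i y i _ ^+ 2)%R.
rewrite [X in (_ + X = _)%R](_ : _ = S); last first.
  by apply: eq_bigr => j _; apply: eq_bigr => i _;
    rewrite mxE [diag_rows _ _ _ _]mxE plane_rshift addr0.
suff -> : (\sum_(j < 2) \sum_i
      (y + diag_rows n (plane u))%R i (@lshift 2 d j) ^+ 2 =
    n%:R * sqnorm (u + m) + \sum_(j < 2) \sum_i y i (@lshift 2 d j) ^+ 2 -
    n%:R * sqnorm m)%R.
  by ring.
rewrite /sqnorm !mulr_sumr -big_split/= -sumrB; apply: eq_bigr => j _.
rewrite (eq_bigr (fun i =>
  y i (@lshift 2 d j) ^+ 2 +
  (u ord0 j *+ 2 * y i (@lshift 2 d j) + u ord0 j ^+ 2)))%R; last first.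
  by move=> i _; rewrite mxE [diag_rows _ _ _ _]mxE plane_lshift; ring.
rewrite !big_split/= -mulr_sumr sumr_const card_ord !mxE.
set Y := (\sum_i y i _)%R.
rewrite -[in LHS]mulr_natl; field.
exact: nN0.
Qed.

End plane.
Arguments plane {R} d u.

Lemma measurable_fun_indic_comp d1 d2 (T1 : measurableType d1)
    (T2 : measurableType d2) (R : realType) (A : set T2) (f : T1 -> T2) :
  measurable A -> measurable_fun setT f ->
  measurable_fun setT (fun x => \1_A (f x) : R).
Proof.
move=> mA mf; apply: (measurableT_comp (f := (\1_A : T2 -> R))) => //.
Qed.

(** * The local inequality for the sphere *)

Section local_estimate.
Context (R : realType) (n d : nat).
Local Notation leb m n := (@lebesgue_matrix R m n).
Local Notation mu1 := (@lebesgue_measure R).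
Context (G : 'M[R]_(n, d.+2) -> \bar R).
Context (n0 : (0 < n)%N) (mG : measurable_fun setT G) (G0 : forall z, 0 <= G z).

(** What remains of the integrand after the two translations, with t in place
    of the squared norm. The cut-off |x|_oo <= 2 / sqrt t is written so that
    its joint measurability in t and x is immediate. *)
Definition radial_kernel (t : R) (x : 'rV[R]_d.+2)
    (y : 'M[R]_(n, d.+2)) : \bar R :=
  (\1_(`]0, 1]%classic : set R) t * \1_(cube 2) (Num.sqrt t *: x))%:E *
  G (diag_rows n x - (Num.sqrt t)^-1 *: y)%R.

Lemma radial_kernel_ge0 t x y : 0 <= radial_kernel t x y.
Proof. by rewrite mule_ge0// lee_fin mulr_ge0. Qed.

Lemma measurable_radial_kernel d0 (T : measurableType d0) (t : T -> R)
    (x : T -> 'rV[R]_d.+2) (y : T -> 'M[R]_(n, d.+2)) :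
  measurable_fun setT t -> measurable_fun setT x -> measurable_fun setT y ->
  measurable_fun setT (fun s => radial_kernel (t s) (x s) (y s)).
Proof.
move=> mt mx my; apply: emeasurable_funM.
  apply/measurable_EFinP; apply: measurable_funM.
    by apply: measurable_fun_indic_comp.
  apply: measurable_fun_indic_comp; first exact: measurable_cube.
  by apply: measurable_fun_scalemx => //; exact: measurable_fun_sqrt.
apply: measurableT_comp => //; apply: measurable_fun_submx.
  by apply: (measurableT_comp (f := diag_rows n)) => //;
    exact: measurable_diag_rows.
apply: measurable_fun_scalemx => //; apply: measurable_fun_inv.
  by move=> s; exact: sqrtr_ge0.
exact: measurable_fun_sqrt.
Qed.

(** The dilations y -> y / sqrt t and x -> sqrt t x produce the powers
    t^(nd/2) and t^(-d/2), and nd >= d. *)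
Lemma integral_radial_kernel t :
  \int[leb 1 d.+2]_x \int[leb n d.+2]_y radial_kernel t x y <=
  (\1_(`]0, 1]%classic : set R) t)%:E *
    ((4 ^+ d.+2)%:E * \int[leb n d.+2]_z G z).
Proof.
rewrite [X in X%:E * _]indicE; case: (boolP (t \in _)) => /= [|tN]; last first.
  rewrite mul0e integral0_eq// => x _; rewrite integral0_eq// => y _.
  by rewrite /radial_kernel indicE (negbTE tN) mul0r mul0e.
rewrite inE/= in_itv/= => /andP[t0 t1].
have s0 : (0 < Num.sqrt t)%R by rewrite sqrtr_gt0.
have s1 : (Num.sqrt t <= 1)%R by rewrite -sqrtr1 ler_sqrt.
have sN0 : ((- (Num.sqrt t)^-1) != 0)%R by rewrite oppr_eq0 invr_eq0 gt_eqF.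
have sN0' : Num.sqrt t != 0%R by rewrite gt_eqF.
under eq_integral => x _.
  rewrite /radial_kernel ge0_integralZl//; last first.
    apply: measurableT_comp => //; apply: measurable_fun_submx => //.
    exact: measurable_fun_scalemx.
  rewrite (_ : \int[_]_y _ =
    (Num.sqrt t ^+ (n * d.+2))%:E * \int[leb n d.+2]_z G z).
    over.
  rewrite [in RHS](ge0_integral_affine_mx (diag_rows n x) sN0)// muleA -EFinM.
  rewrite normrN ger0_norm ?invr_ge0 ?ltW// -exprMn mulfV// expr1n mul1e.
  by apply: eq_integral => y _; rewrite scaleNr addrC.
rewrite ge0_integralZr//; last 2 first.
- apply/measurable_EFinP; apply: measurable_funM => //.
  apply: measurable_fun_indic_comp; first exact: measurable_cube.
  exact: measurable_fun_scalemx.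
- by rewrite mule_ge0 ?lee_fin ?exprn_ge0 ?sqrtr_ge0// integral_ge0.
rewrite mul1e muleA lee_pmul//.
- by rewrite mule_ge0 ?lee_fin ?exprn_ge0 ?sqrtr_ge0// integral_ge0.
- by rewrite integral_ge0.
have : \int[leb 1 d.+2]_x (\1_(cube 2) x : R)%:E = (4 ^+ d.+2)%:E.
  rewrite integral_indic; [|exact: measurableT|exact: measurable_cube].
  rewrite setIT [LHS]lebesgue_cube// mul1n; congr (_ ^+ _)%:E; ring.
rewrite (ge0_integral_affine_mx 0 sN0'); last 2 first.
- by apply/measurable_EFinP; apply: measurable_indic; exact: measurable_cube.
- by move=> y; rewrite lee_fin.
rewrite mul1n ger0_norm ?sqrtr_ge0//.
under [X in _ * X]eq_integral do rewrite addr0.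
move=> <-; rewrite [X in X * _](_ : _ =
    \int[leb 1 d.+2]_x (\1_(cube 2) (Num.sqrt t *: x) : R)%:E).
  rewrite muleC lee_wpmul2r ?integral_ge0// lee_fin ler_wiXn2l ?sqrtr_ge0//.
  by rewrite leq_pmull.
apply: eq_integral => x _; rewrite [X in (X * _)%R]indicE mem_set/= ?mul1r//.
by rewrite in_itv/= t0.
Qed.

Lemma measurable_cone_kernel : measurable_fun setT
  (fun z : 'M[R]_(n, d.+2) * 'rV[R]_d.+2 =>
    (\1_(@punctured_ball R n d.+2) z.1 * \1_(cube 1) z.2)%:E *
     G (diag_rows n z.2 - (enorm z.1)^-1 *: z.1)%R).
Proof.
apply: emeasurable_funM.
  apply/measurable_EFinP; apply: measurable_funM.
    apply: measurable_fun_indic_comp; last exact: measurable_fst.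
    exact: measurable_punctured_ball.
  apply: measurable_fun_indic_comp; last exact: measurable_snd.
  exact: measurable_cube.
apply: (measurableT_comp mG); apply: measurable_fun_submx.
  apply: (measurableT_comp (f := diag_rows n)); last exact: measurable_snd.
  exact: measurable_diag_rows.
apply: measurable_fun_scalemx; last exact: measurable_fst.
apply: measurable_fun_inv; first by move=> z; exact: enorm_ge0.
apply: (measurableT_comp (f := @enorm R n d.+2)); last exact: measurable_fst.
exact: measurable_enorm.
Qed.

(** For fixed u, translate y by the diagonal point (u, 0) and then x by
    (u, 0) / t, with t the new norm: the argument x - y / t of G is unchanged
    and u remains only in t. As t <= 1 and |u|_oo <= 1, the cube |x|_oo <= 1
    ends up inside |t x|_oo <= 2. *)
Lemma cone_integral_translate (u : 'rV[R]_2) : @cube R 1 2 1 u ->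
  \int[leb n d.+2]_y \int[leb 1 d.+2]_x
    ((\1_(@punctured_ball R n d.+2) y * \1_(cube 1) x)%:E *
     G (diag_rows n x - (enorm y)^-1 *: y)%R) <=
  \int[leb n d.+2]_y \int[leb 1 d.+2]_x
    radial_kernel (enorm (y + diag_rows n (plane d u)) ^+ 2) x y.
Proof.
move=> uc.
pose F y := \int[leb 1 d.+2]_x
    ((\1_(@punctured_ball R n d.+2) y * \1_(cube 1) x)%:E *
     G (diag_rows n x - (enorm y)^-1 *: y)%R).
pose f (z : 'M[R]_(n, d.+2) * 'rV[R]_d.+2) :=
    (\1_(@punctured_ball R n d.+2) z.1 * \1_(cube 1) z.2)%:E *
     G (diag_rows n z.2 - (enorm z.1)^-1 *: z.1)%R.
have f0 z : 0 <= f z by rewrite mule_ge0// lee_fin mulr_ge0.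
have mf : measurable_fun setT f := measurable_cone_kernel.
have mF : measurable_fun setT F.
  exact: (measurable_fun_fubini_tonelli_F (m2 := leb 1 d.+2) f).
have F0 y : 0 <= F y by apply: integral_ge0 => x _; exact: (f0 (y, x)).
rewrite -[leLHS](ge0_integral_translate_mx (diag_rows n (plane d u)) mF F0).
apply: ge0_le_integral; first exact: measurableT.
- by move=> y _; exact: F0.
- by apply: (measurableT_comp mF); apply: measurable_fun_addmx.
- pose g (z : 'M[R]_(n, d.+2) * 'rV[R]_d.+2) :=
    radial_kernel (enorm (z.1 + diag_rows n (plane d u)) ^+ 2) z.2 z.1.
  suff mg : measurable_fun setT g.
    exact: (measurable_fun_fubini_tonelli_F (m2 := leb 1 d.+2) g mg
      (fun=> radial_kernel_ge0 _ _ _)).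
  apply: measurable_radial_kernel => //; apply: measurable_funX.
  apply: (measurableT_comp (f := @enorm R n d.+2));
    first exact: measurable_enorm.
  exact: measurable_fun_addmx.
move=> y _; rewrite /F.
set y' := (y + _)%R; set t := enorm y'.
have t0 : (0 <= t)%R := enorm_ge0 _.
rewrite -[leLHS](ge0_integral_translate_mx (t^-1 *: plane d u)%R); last 2 first.
- exact: (measurable_fun_pair2 (f := f) y' mf).
- by move=> x; exact: (f0 (y', x)).
have mfy : measurable_fun setT (fun x => f (y', x)).
  exact: (measurable_fun_pair2 (f := f) y' mf).
apply: ge0_le_integral => //.
- by move=> x _; exact: (f0 (y', _)).
- by apply: (measurableT_comp mfy); apply: measurable_fun_addmx.
- exact: measurable_radial_kernel.
move=> x _; rewrite /radial_kernel sqrtr_sqr ger0_norm// diag_rowsD diag_rowsZ.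
rewrite scalerDr opprD addrACA subrr addr0.
rewrite lee_wpmul2r// lee_fin.
have [y'P|y'P] := pselect (@punctured_ball R n d.+2 y'); last first.
  by rewrite indicE memNset// mul0r mulr_ge0.
have [xC|xC] := pselect (cube 1 (x + t^-1 *: plane d u)%R); last first.
  by rewrite [X in (_ * X <= _)%R]indicE memNset// mulr0 mulr_ge0.
have /andP[tp t1] : (0 < t <= 1)%R by [].
rewrite !indicE !mem_set ?mulr1//.
  move=> i j; have := xC i j; rewrite mxE [(_ *: plane _ _)%R _ _]mxE => xij;
    rewrite mxE.
  have uij : (`|plane d u i j| <= 1)%R.
    rewrite ord1; case: (@split_ordP 2 d j) => k ->.
      by rewrite plane_lshift.
    by rewrite plane_rshift normr0.
  rewrite (_ : t * x i j =
    t * (x i j + t^-1 * plane d u i j) - plane d u i j)%R.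
    apply: (le_trans (ler_normB _ _)); rewrite (_ : 2 = 1 + 1)%R// lerD//.
    by rewrite normrM ger0_norm// mulr_ile1.
  by rewrite mulrDr mulrA mulfV ?gt_eqF// mul1r addrK.
by rewrite /= in_itv/= exprn_gt0//= expr_le1.
Qed.

(** Average cone_integral_translate over u in the square |u|_oo <= 1, enlarge
    the square to the whole plane and integrate radially. The area 4 of the
    square cancels the constant of ge0_integral_sqnorm_affine. *)
Lemma cone_integral_le :
  \int[leb n d.+2]_y \int[leb 1 d.+2]_x
    ((\1_(@punctured_ball R n d.+2) y * \1_(cube 1) x)%:E *
     G (diag_rows n x - (enorm y)^-1 *: y)%R) <=
  (4 ^+ d.+2)%:E * \int[leb n d.+2]_z G z.
Proof.
set J := (leLHS).
have J0 : 0 <= J.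
  by apply: integral_ge0 => y _; apply: integral_ge0 => x _;
    rewrite mule_ge0// lee_fin mulr_ge0.
pose Psi t y := \int[leb 1 d.+2]_x radial_kernel t x y.
have Psi0 t y : 0 <= Psi t y.
  by apply: integral_ge0 => x _; exact: radial_kernel_ge0.
have mPsi : measurable_fun setT (fun z : R * 'M[R]_(n, d.+2) => Psi z.1 z.2).
  pose g (z : (R * 'M[R]_(n, d.+2)) * 'rV[R]_d.+2) :=
    radial_kernel z.1.1 z.2 z.1.2.
  have mg : measurable_fun setT g.
    by apply: measurable_radial_kernel => //; exact: measurableT_comp.
  exact: (measurable_fun_fubini_tonelli_F (m2 := leb 1 d.+2) g mg
    (fun=> radial_kernel_ge0 _ _ _)).
pose N (u : 'rV[R]_2) (y : 'M[R]_(n, d.+2)) :=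
  (enorm (y + diag_rows n (plane d u)) ^+ 2)%R.
have mN : measurable_fun setT
    (fun z : 'rV[R]_2 * 'M[R]_(n, d.+2) => Psi (N z.1 z.2) z.2).
  have mN1 : measurable_fun setT
      (fun z : 'rV[R]_2 * 'M[R]_(n, d.+2) => N z.1 z.2).
    apply: measurable_funX.
    apply: (measurableT_comp (f := @enorm R n d.+2));
      first exact: measurable_enorm.
    apply: measurable_fun_addmx; first exact: measurable_snd.
    apply: (measurableT_comp (f := diag_rows n));
      first exact: measurable_diag_rows.
    apply: (measurableT_comp (f := plane d)); first exact: measurable_plane.
    exact: measurable_fst.
  exact: (measurableT_comp mPsi (measurable_fun_pair mN1 measurable_snd)).
have Jle u : @cube R 1 2 1 u -> J <= \int[leb n d.+2]_y Psi (N u y) y.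
  exact: cone_integral_translate.
clearbody J.
have four : 4%:E = leb 1 2 (cube 1).
  by rewrite [RHS]lebesgue_cube//; congr EFin; ring.
rewrite -(@lee_pmul2l _ 4%:E)// ?lte_fin//.
apply: (@le_trans _ _ (\int[leb 1 2]_u \int[leb n d.+2]_y Psi (N u y) y)).
  have -> : 4%:E * J = \int[leb 1 2]_(u in cube 1) J.
    rewrite integral_cst; last exact: measurable_cube.
    by rewrite muleC; congr (_ * _).
  have mNF : measurable_fun setT (fun u => \int[leb n d.+2]_y Psi (N u y) y).
    exact: (measurable_fun_fubini_tonelli_F (m2 := leb n d.+2) _ mN
      (fun=> Psi0 _ _)).
  have NF0 u : 0 <= \int[leb n d.+2]_y Psi (N u y) y.
    by apply: integral_ge0 => y _.
  apply: (@le_trans _ _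
      (\int[leb 1 2]_(u in cube 1) \int[leb n d.+2]_y Psi (N u y) y)).
    apply: ge0_le_integral; first exact: measurable_cube.
    - by [].
    - exact: measurable_cst.
    - exact: measurable_funTS.
    - by move=> u; exact: Jle.
  apply: ge0_subset_integral => //; exact: measurable_cube.
rewrite [leLHS](@fubini_tonelli _ _ _ _ R (leb 1 2) (leb n d.+2) _ mN
  (fun=> Psi0 _ _)).
have mPsit y : measurable_fun setT (fun t => Psi t y).
  exact: (measurable_fun_pair1 (f := fun z => Psi z.1 z.2) y mPsi).
have mPsiF : measurable_fun setT (fun y => \int[mu1]_t Psi t y).
  exact: (measurable_fun_fubini_tonelli_G (m1 := mu1) _ mPsi (fun=> Psi0 _ _)).
have PsiF0 y : 0 <= \int[mu1]_t Psi t y by apply: integral_ge0 => t _.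
apply: (@le_trans _ _ (\int[leb n d.+2]_y (4%:E * \int[mu1]_t Psi t y))).
  apply: ge0_le_integral; first exact: measurableT.
  - by move=> y _; apply: integral_ge0 => t _.
  - exact: (measurable_fun_fubini_tonelli_G (m1 := leb 1 2) _ mN
      (fun=> Psi0 _ _)).
  - apply: emeasurable_funM; [exact: measurable_cst|exact: mPsiF].
  move=> y _; have [m [q mq]] := enorm_add_plane y n0.
  rewrite /N; under eq_integral do rewrite mq.
  exact: (ge0_integral_sqnorm_affine m q n0 (mPsit y) (fun t => Psi0 t y)).
rewrite ge0_integralZl//.
rewrite lee_pmul2l//.
have -> : \int[leb n d.+2]_y \int[mu1]_t Psi t y =
    \int[mu1]_t \int[leb n d.+2]_y Psi t y.
  exact/esym/(@fubini_tonelli _ _ _ _ R mu1 (leb n d.+2) _ mPsi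
    (fun=> Psi0 _ _)).
have GI0 : 0 <= (4 ^+ d.+2)%:E * \int[leb n d.+2]_z G z.
  by rewrite mule_ge0 ?lee_fin ?exprn_ge0// integral_ge0.
have -> : (4 ^+ d.+2)%:E * \int[leb n d.+2]_z G z =
  \int[mu1]_t ((\1_(`]0, 1]%classic : set R) t)%:E *
    ((4 ^+ d.+2)%:E * \int[leb n d.+2]_z G z)).
  rewrite ge0_integralZr//.
    rewrite integral_indic// setIT.
    rewrite [X in _ = X * _]lebesgue_measure_itv/= lte_fin ltr01.
    by rewrite oppr0 adde0 mul1e.
  by apply/measurable_EFinP; apply: measurable_indic.
apply: ge0_le_integral; first exact: measurableT.
- by move=> t _; apply: integral_ge0 => y _.
- exact: (measurable_fun_fubini_tonelli_F (m2 := leb n d.+2) _ mPsi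
  (fun=> Psi0 _ _)).
- apply: emeasurable_funM; last exact: measurable_cst.
  by apply/measurable_EFinP; apply: measurable_indic.
move=> t _; apply: le_trans (integral_radial_kernel t).
have mker : measurable_fun setT
    (fun z : 'M[R]_(n, d.+2) * 'rV[R]_d.+2 => radial_kernel t z.2 z.1).
  by apply: measurable_radial_kernel;
    [exact: measurable_cst|exact: measurable_snd|
    exact: measurable_fst].
by rewrite [leLHS](@fubini_tonelli _ _ _ _ R (leb n d.+2) (leb 1 d.+2) _ mker
  (fun=> radial_kernel_ge0 _ _ _)).
Qed.

End local_estimate.

(** * Hoelder's inequality with weights *)

Lemma lee_prod (R : realType) (I : Type) (s : seq I) (P : pred I)
    (f g : I -> \bar R) :
  (forall i, P i -> 0 <= f i) -> (forall i, P i -> f i <= g i) ->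
  \prod_(i <- s | P i) f i <= \prod_(i <- s | P i) g i.
Proof.
move=> f0 fg.
suff /andP[] : 0 <= \prod_(i <- s | P i) f i <= \prod_(i <- s | P i) g i by [].
elim/big_ind2 : _ => //; first by rewrite lexx lee01.
  by move=> ? ? ? ? /andP[? ?] /andP[? ?]; rewrite mule_ge0//= lee_pmul.
by move=> i Pi; rewrite f0//= fg.
Qed.

Lemma poweR_prod (R : realType) (I : Type) (s : seq I) (f : I -> \bar R)
    (r : R) :
  (forall i, 0 <= f i) ->
  (\prod_(i <- s) f i) `^ r = \prod_(i <- s) f i `^ r.
Proof.
move=> f0; elim: s => [|i s IH]; first by rewrite !big_nil poweR1r.
by rewrite !big_cons poweRM// ?IH// prode_ge0.
Qed.

Lemma ler_poweR (R : realType) (r : R) (x y : \bar R) :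
  (0 <= r)%R -> 0 <= x -> x <= y -> x `^ r <= y `^ r.
Proof.
move=> r0 x0 xy; apply: gt0_ler_poweR => //; rewrite in_itv/= ?leey ?andbT//.
exact: le_trans xy.
Qed.

Section hoelder.
Context (R : realType) (I : finType) (P : pred I) (th : I -> R).
Context (th0 : forall i, P i -> (0 < th i)%R).
Context (th1 : (\sum_(i | P i) th i = 1)%R).

(** The weighted inequality between the arithmetic and geometric means, by
    multiplying the inequalities a i / M <= expR (a i / M - 1) raised to the
    powers th i, M being the arithmetic mean. *)
Lemma powR_amgm (a : I -> R) : (forall i, P i -> 0 <= a i)%R ->
  (\prod_(i | P i) a i `^ th i <= \sum_(i | P i) th i * a i)%R.
Proof.
move=> a0; set M := (leRHS).
have tha0 i : P i -> (0 <= th i * a i)%R.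
  by move=> Pi; rewrite mulr_ge0 ?a0// ltW ?th0.
have M0 : (0 <= M)%R by exact: sumr_ge0.
move: M0; rewrite le_eqVlt => /predU1P[M0|M0].
  have [i Pi] : exists i, P i.
    apply: contrapT => nP; move: th1; rewrite big_pred0 => [/esym/eqP|i].
      by rewrite oner_eq0.
    by apply/negP => Pi; apply: nP; exists i.
  have ai : a i = 0%R.
    have /eqP := psumr_eq0P tha0 (esym M0) Pi.
    by rewrite mulf_eq0 gt_eqF ?th0//= => /eqP.
  by rewrite (bigD1 i)//= ai powR0 ?gt_eqF ?th0// mul0r -M0.
rewrite (_ : M = \prod_(i | P i) (M `^ th i * expR (th i * (a i / M - 1))))%R.
  apply: ler_prod => i Pi; rewrite powR_ge0/=.
  rewrite [(th i * _)%R]mulrC expRM -powRM ?expR_ge0//; last exact: ltW.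
  apply: ge0_ler_powR; rewrite ?nnegrE ?a0//; first by rewrite ltW ?th0.
    by rewrite mulr_ge0 ?expR_ge0// ltW.
  rewrite mulrC -ler_pdivrMr// (le_trans _ (expR_ge1Dx _))//; lra.
have -> : (\prod_(i | P i) (M `^ th i * expR (th i * (a i / M - 1))) =
    (\prod_(i | P i) M `^ th i) * expR (M / M - 1))%R.
  rewrite big_split/= -expR_sum; congr (_ * expR _)%R.
  rewrite -[X in (_ - X)%R]th1 [in RHS]/M mulr_suml -sumrB.
  by apply: eq_bigr => i _; rewrite mulrBr mulr1 mulrA.
rewrite mulfV ?gt_eqF// subrr expR0 mulr1.
transitivity (M `^ (\sum_(i | P i) th i))%R; first by rewrite th1 powRr1 ?ltW.
by rewrite /powR gt_eqF// mulr_suml expR_sum.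
Qed.

Lemma poweR_amgm (a : I -> \bar R) : (forall i, P i -> 0 <= a i) ->
  \prod_(i | P i) a i `^ th i <= \sum_(i | P i) (th i)%:E * a i.
Proof.
move=> a0.
have [/existsP[i /andP[Pi /eqP ai]]|] := boolP [exists i, P i && (a i == +oo)].
  rewrite [leRHS](_ : _ = +oo) ?leey//; apply/eqP; rewrite esum_eqy.
    apply/existsP; exists i; rewrite unfold_in Pi/= ai gt0_muley//.
    by rewrite lte_fin th0.
  move=> j Pj; apply/eqP => aj; have : 0 <= (th j)%:E * a j.
    by rewrite mule_ge0 ?a0// lee_fin ltW// th0.
  by rewrite aj.
rewrite negb_exists => /forallP afin.
have aE i : P i -> a i = (fine (a i))%:E.
  move=> Pi; rewrite fineK// ge0_fin_numE ?a0// ltey.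
  by have := afin i; rewrite Pi.
rewrite (eq_bigr (fun i => (fine (a i) `^ th i)%:E)); last first.
  by move=> i Pi; rewrite [in LHS]aE.
rewrite [leRHS](eq_bigr (fun i => (th i * fine (a i))%:E)); last first.
  by move=> i Pi; rewrite [in LHS]aE.
rewrite prodEFin sumEFin lee_fin; apply: powR_amgm => i Pi.
exact/fine_ge0/a0.
Qed.

(** After normalizing the integrals to 1 this is the integral of the
    inequality between the means. The normalization fails when an integral is
    0 or infinite; then one side of the inequality is trivial. *)
Lemma ge0_hoelder_pos d0 (T : measurableType d0)
    (mu : {measure set T -> \bar R}) (D : set T) (a : I -> T -> \bar R) :
  measurable D -> (forall i, measurable_fun D (a i)) ->
    (forall i x, 0 <= a i x) ->
  \int[mu]_(x in D) \prod_(i | P i) a i x `^ th i <=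
  \prod_(i | P i) (\int[mu]_(x in D) a i x) `^ th i.
Proof.
move=> mD ma a0.
have ia0 i : 0 <= \int[mu]_(x in D) a i x by exact: integral_ge0.
have mapow i : measurable_fun D (fun x => a i x `^ th i).
  by apply: (measurableT_comp (f := fun y : \bar R => y `^ th i)) => //;
    exact: measurable_poweR.
have mprod : measurable_fun D (fun x => \prod_(i | P i) a i x `^ th i).
  exact: emeasurable_prod_fun.
have [/existsP[i /andP[Pi /eqP ai0]]|] :=
    boolP [exists i, P i && (\int[mu]_(x in D) a i x == 0)].
  rewrite (ge0_ae_eq_integral (g := cst 0))//; last 2 first.
  - by move=> x _; apply: prode_ge0 => j _; exact: poweR_ge0.
  - have /(ae_eq_integral_abs mu mD (ma i)) : \int[mu]_(x in D) `|a i x| = 0.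
      by under eq_integral do rewrite gee0_abs//.
    apply: filterS => x aix Dx; rewrite /= (bigD1 i)//=.
    have -> : a i x = 0 by exact: aix.
    by rewrite poweR0r ?mul0e// gt_eqF ?th0.
  by rewrite integral0 prode_ge0// => j _; exact: poweR_ge0.
rewrite negb_exists => /forallP an0.
have agt0 i : P i -> 0 < \int[mu]_(x in D) a i x.
  by move=> Pi; rewrite lt0e ia0 andbT; have := an0 i; rewrite Pi.
have [/existsP[i /andP[Pi /eqP aiy]]|] :=
    boolP [exists i, P i && (\int[mu]_(x in D) a i x == +oo)].
  rewrite [leRHS](_ : _ = +oo) ?leey// (bigD1 i)//= aiy poweRyr ?gt_eqF ?th0//.
  rewrite gt0_mulye//; apply: (big_ind (fun z : \bar R => 0 < z)) =>
    [|x y|j /andP[Pj _]].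
  - exact: lte01.
  - exact: mule_gt0.
  - by rewrite poweR_gt0 ?agt0.
rewrite negb_exists => /forallP afin.
pose c i : R := fine (\int[mu]_(x in D) a i x).
have cE i : P i -> \int[mu]_(x in D) a i x = (c i)%:E.
  move=> Pi; rewrite /c fineK// ge0_fin_numE// ltey.
  by have := afin i; rewrite Pi.
have c0 i : P i -> (0 < c i)%R by move=> Pi; rewrite -lte_fin -cE// agt0.
pose K := (\prod_(i | P i) c i `^ th i)%R.
have K0 : (0 <= K)%R by rewrite prodr_ge0// => i _; exact: powR_ge0.
have -> : \prod_(i | P i) (\int[mu]_(x in D) a i x) `^ th i = K%:E.
  by rewrite -prodEFin; apply: eq_bigr => i Pi; rewrite cE.
have maZ i : measurable_fun D (fun x => (th i / c i)%:E * a i x).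
  by apply: emeasurable_funM => //; exact: measurable_cst.
have maif i : measurable_fun D (fun x =>
  if P i then (th i / c i)%:E * a i x else 0).
  by case: (P i) => //; exact: measurable_cst.
have maS : measurable_fun D (fun x => \sum_(i | P i) (th i / c i)%:E * a i x).
  rewrite (_ : (fun _ => _) = fun x => \sum_i
      if P i then (th i / c i)%:E * a i x else 0).
    exact: emeasurable_sum.
  by apply/funext => x; rewrite big_mkcond.
have thc0 i : P i -> (0 <= th i / c i)%R.
  by move=> Pi; rewrite divr_ge0// ltW ?th0 ?c0.
have S0 x : 0 <= \sum_(i | P i) (th i / c i)%:E * a i x.
  by rewrite sume_ge0// => i Pi; rewrite mule_ge0// lee_fin thc0.
apply: (@le_trans _ _ (\int[mu]_(x in D)
    (K%:E * \sum_(i | P i) (th i / c i)%:E * a i x))).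
  apply: ge0_le_integral => //.
  - by move=> x _; apply: prode_ge0 => j _; exact: poweR_ge0.
  - by apply: emeasurable_funM => //; exact: measurable_cst.
  move=> x _;
    rewrite (eq_bigr (fun i =>
    (c i `^ th i)%:E * ((c i)^-1%:E * a i x) `^ th i)); last first.
    move=> i Pi; rewrite -poweR_EFin -poweRM ?lee_fin ?(ltW (c0 i Pi))//;
      last first.
      by rewrite mule_ge0// lee_fin invr_ge0 ltW// c0.
    by rewrite muleA -EFinM mulfV ?gt_eqF ?c0// mul1e.
  rewrite big_split/= prodEFin lee_wpmul2l ?lee_fin//.
  apply: (le_trans (poweR_amgm _)) => [i Pi|].
    by rewrite mule_ge0// lee_fin invr_ge0 ltW// c0.
  by apply: lee_sum => i _; rewrite muleA -EFinM.
rewrite ge0_integralZl// (_ : \int[mu]_(x in D) _ = 1) ?mule1//.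
under eq_integral do rewrite big_mkcond.
rewrite ge0_integral_sum//; last first.
- by move=> i x _; case: ifP => // Pi; rewrite mule_ge0// lee_fin thc0.
rewrite -th1 big_mkcond/= [in RHS]big_mkcond/= -sumEFin; apply: eq_bigr => i _.
case: ifPn => Pi; last by rewrite integral0.
rewrite ge0_integralZl// ?lee_fin ?thc0// cE// -EFinM divfK//.
by rewrite gt_eqF// c0.
Qed.

End hoelder.

(** The weights may vanish: this happens for the indices with p_i infinite. A
    zero weight turns both factors into 1, even if the integral is infinite,
    since x `^ 0 = 1 for all x. *)
Lemma ge0_hoelder (R : realType) (I : finType) (th : I -> R) d0
    (T : measurableType d0) (mu : {measure set T -> \bar R}) (D : set T)
    (a : I -> T -> \bar R) :
  (forall i, 0 <= th i)%R -> (\sum_i th i = 1)%R ->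
  measurable D -> (forall i, measurable_fun D (a i)) ->
    (forall i x, 0 <= a i x) ->
  \int[mu]_(x in D) \prod_i a i x `^ th i <=
  \prod_i (\int[mu]_(x in D) a i x) `^ th i.
Proof.
move=> th0 th1 mD ma a0.
have prodE (b : I -> \bar R) :
    \prod_i b i `^ th i = \prod_(i | th i != 0%R) b i `^ th i.
  by rewrite [RHS]big_rmcond// => i /negbNE/eqP ->; rewrite poweRe0.
under eq_integral do rewrite prodE; rewrite prodE.
apply: ge0_hoelder_pos => // [i thi|]; first by rewrite lt0r thi th0.
by rewrite big_rmcond// => i /negbNE/eqP.
Qed.

(** Jensen's inequality for a concave power, as Hoelder's inequality for g and
    the constant 1. *)
Lemma integral_poweR_le (R : realType) d0 (T : measurableType d0)
    (mu : {measure set T -> \bar R}) (D : set T) (g : T -> \bar R) (al : R) :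
  (0 <= al <= 1)%R -> measurable D -> measurable_fun D g ->
    (forall x, 0 <= g x) ->
  \int[mu]_(x in D) g x `^ al <=
    mu D `^ (1 - al) * (\int[mu]_(x in D) g x) `^ al.
Proof.
move=> /andP[al0 al1] mD mg g0.
pose th b := if b then al else (1 - al)%R.
pose a b x := if b then g x else 1.
rewrite [leLHS](_ : _ = \int[mu]_(x in D) \prod_(b : bool) a b x `^ th b);
  last first.
  by apply: eq_integral => x _; rewrite big_bool /a /th /= powR1 mule1.
apply: (le_trans (ge0_hoelder _ _ _ _ _ _)).
- by case => //=; rewrite subr_ge0.
- by rewrite big_bool /th /= addrC subrK.
- by [].
- by case => //=; exact: measurable_cst.
- by case => /=.
by rewrite big_bool /a /th /= integral_cst// mul1e muleC.
Qed.

(** * Surface integrals and essential suprema *)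

Lemma integral_indicM (R : realType) d0 (T : measurableType d0)
    (mu : {measure set T -> \bar R}) (D : set T) (g : T -> \bar R) :
  \int[mu]_(x in D) g x = \int[mu]_x ((\1_D x)%:E * g x).
Proof.
rewrite integral_mkcond epatch_indic.
by apply: eq_integral => x _; rewrite muleC.
Qed.

Lemma ge0_integral_mrestr (R : realType) d0 (T : measurableType d0)
    (mu : {measure set T -> \bar R}) (D : set T) (mD : measurable D)
    (g : T -> \bar R) :
  measurable_fun setT g -> (forall x, 0 <= g x) ->
  \int[mrestr mu mD]_x g x = \int[mu]_(x in D) g x.
Proof.
move=> mg g0.
rewrite -(setvU D) ge0_integral_setU//; last 3 first.
- exact: measurableC.
- by rewrite setvU.
- by apply/disj_setPS => x [].
rewrite (_ : \int[_]_(x in ~` D) g x = 0) ?add0e; last first.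
  rewrite (eq_measure_integral mzero) ?integral_measure_zero// => A mA AD.
  change (mu (A `&` D) = 0); rewrite (_ : A `&` D = set0) ?measure0//.
  by apply/seteqP; split => // x [/AD].
apply: eq_measure_integral => A mA AD.
by change (mu (A `&` D) = mu A); rewrite setIidl.
Qed.

Section surface_integral.
Context (R : realType) (n d : nat).
Local Notation leb m n := (@lebesgue_matrix R m n).

Definition sphere_proj (y : 'M[R]_(n, d)) : 'M[R]_(n, d) :=
  ((enorm y)^-1 *: y)%R.

Lemma measurable_sphere_proj : measurable_fun setT sphere_proj.
Proof.
apply: measurable_fun_scalemx; last exact: measurable_id.
apply: measurable_fun_inv; first by move=> y; exact: enorm_ge0.
exact: measurable_enorm.
Qed.

Lemma sphere_proj_usphere y : punctured_ball y -> usphere R n d (sphere_proj y).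
Proof.
move=> /andP[y0 _].
have : (enorm (sphere_proj y) ^+ 2 = 1)%R.
  rewrite enorm_sqr (eq_bigr (fun i =>
    (enorm y ^+ 2)^-1 * \sum_j y i j ^+ 2))%R.
    by rewrite -mulr_sumr -enorm_sqr mulVf// expf_neq0// gt_eqF.
  move=> i _; rewrite mulr_sumr; apply: eq_bigr => j _.
  by rewrite mxE exprMn exprVn.
by move=> /eqP; rewrite sqrp_eq1 ?enorm_ge0// => /eqP.
Qed.

(** Integration in polar coordinates, which here is just the definition of the
    surface measure as a cone measure. *)
Lemma surface_integralE (h : 'M[R]_(n, d) -> \bar R) :
  measurable_fun setT h -> (forall y, 0 <= h y) ->
  \int[@surface_measure R n d]_(y in usphere R n d) h y =
  (n * d)%:R%:E * \int[leb n d]_(y in @punctured_ball R n d) h (sphere_proj y).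
Proof.
move=> mh h0; rewrite integral_indicM.
have nd0 : (0 <= (n * d)%:R :> R)%R by [].
pose mu := mscale (NngNum nd0) (pushforward_measure
  (mrestr (leb n d) (@measurable_punctured_ball R n d)) measurable_sphere_proj).
have mg : measurable_fun setT (fun y => (\1_(usphere R n d) y)%:E * h y).
  apply: emeasurable_funM => //; apply/measurable_EFinP.
  apply: measurable_indic; exact: measurable_usphere.
have g0 y : 0 <= (\1_(usphere R n d) y)%:E * h y by rewrite mule_ge0// lee_fin.
rewrite (eq_measure_integral mu) => [|A mA _]; last by [].
rewrite ge0_integral_mscale//=; congr (_ * _).
rewrite (ge0_integral_pushforward measurable_sphere_proj)//=.
rewrite ge0_integral_mrestr//;
  last exact: (measurableT_comp mg measurable_sphere_proj).
apply: eq_integral => y /[!inE] yP /=.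
by rewrite indicE mem_set ?mul1e//; exact: sphere_proj_usphere.
Qed.

Lemma punctured_ball_cube : @punctured_ball R n d `<=` cube 1.
Proof.
move=> y /andP[_ y1] i j; rewrite -(@ler_pXn2r _ 2) ?nnegrE// expr1n.
rewrite real_normK ?num_real//; apply: (@le_trans _ _ (enorm y ^+ 2)%R).
  rewrite enorm_sqr (bigD1 i)//= (bigD1 j)//= -addrA lerDl addr_ge0//.
    by rewrite sumr_ge0// => k _; rewrite sqr_ge0.
  by rewrite sumr_ge0// => k _; rewrite sumr_ge0// => l _; rewrite sqr_ge0.
by rewrite expr_le1// enorm_ge0.
Qed.

Lemma usphere_cube : usphere R n d `<=` cube 1.
Proof.
move=> y y1; apply: punctured_ball_cube.
by rewrite /punctured_ball/= y1 ltr01 lexx.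
Qed.

Lemma lebesgue_punctured_ball_fin :
  leb n d (@punctured_ball R n d) \is a fin_num.
Proof.
rewrite ge0_fin_numE//.
apply: (@le_lt_trans _ _ (leb n d (cube 1))).
  apply: le_measure; rewrite ?inE//; [exact: measurable_punctured_ball|
    exact: measurable_cube|exact: punctured_ball_cube].
by rewrite [ltLHS]lebesgue_cube ?ltry.
Qed.

End surface_integral.

(** A nonempty open set is not negligible, so the essential supremum of a
    continuous function is an actual upper bound. *)
Lemma continuous_le_Lnormy (R : realType) m n (f : 'M[R]_(m, n) -> R) x :
  continuous f -> (forall z, 0 <= f z)%R ->
  (f x)%:E <= 'N[@lebesgue_matrix R m n]_+oo[EFin \o f].
Proof.
move=> cf f0; rewrite leNgt; apply/negP => Nfx.
have oT : open [set: 'M[R]_(m, n)] by exact: openT.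
have := Lnorm_ge0 (@lebesgue_matrix R m n) +oo (EFin \o f).
move: Nfx; rewrite unlock (lebesgue_matrix_open_gt0 oT (x := x))//.
set N := ess_sup _ _ => Nfx N0.
have NE : N = (fine N)%:E.
  by rewrite fineK// ge0_fin_numE// (lt_trans Nfx)// ltry.
pose U := f @^-1` `](fine N), +oo[%classic.
have oU : open U by move/continuousP: cf; apply; exact: interval_open.
have Ux : U x by rewrite /U/= in_itv/= andbT -lte_fin -NE.
have := lebesgue_matrix_open_gt0 oU Ux.
rewrite (_ : lebesgue_matrix U = 0) ?ltxx//.
apply: measure_negligible; first exact: open_measurable_mx.
have := @ess_sup_ge _ _ _ (@lebesgue_matrix R m n) (abse \o (EFin \o f)).
apply: negligibleS => z; rewrite /U/= in_itv/= andbT -lte_fin -NE => Nfz.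
by apply/negP; rewrite -ltNge ger0_norm.
Qed.

(** * Local bounds for the spherical average *)

Section product_local.
Context (R : realType) (n d : nat).
Local Notation leb m n := (@lebesgue_matrix R m n).
Local Notation pball := (@punctured_ball R n d.+2).
Context (n0 : (0 < n)%N).

Lemma measurable_prod_shift (F : 'I_n -> 'rV[R]_d.+2 -> \bar R) :
  (forall i, measurable_fun setT (F i)) ->
  measurable_fun setT (fun z : 'rV[R]_d.+2 * 'M[R]_(n, d.+2) =>
    \prod_(i < n) F i (z.1 - row i (sphere_proj z.2))%R).
Proof.
move=> mF; apply: emeasurable_prod_fun => i.
apply: (measurableT_comp (mF i)); apply: measurable_fun_submx.
  exact: measurable_fst.
apply: (measurableT_comp (f := fun y : 'M[R]_(n, d.+2) => row i y)).
  exact: measurable_row.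
apply: (measurableT_comp (f := @sphere_proj R n d.+2));
  last exact: measurable_snd.
exact: measurable_sphere_proj.
Qed.

(** The local inequality for the product of the F i (c + _) cut off to cube 2:
    the cut-off is harmless because x lies in cube 1 and so do the rows of
    y. *)
Lemma average_local_le (F : 'I_n -> 'rV[R]_d.+2 -> \bar R) (c : 'rV[R]_d.+2) :
  (forall i, measurable_fun setT (F i)) -> (forall i x, 0 <= F i x) ->
  \int[leb 1 d.+2]_(x in cube 1) \int[leb n d.+2]_(y in pball)
    (\prod_(i < n) F i (c + x - row i (sphere_proj y))%R) <=
  (4 ^+ d.+2)%:E * \prod_(i < n) \int[leb 1 d.+2]_(z in cube 2) F i (c + z)%R.
Proof.
move=> mF F0.
pose g i (z : 'rV[R]_d.+2) : \bar R := (\1_(cube 2) z)%:E * F i (c + z)%R.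
have mFc i : measurable_fun setT (fun z => F i (c + z)%R).
  apply: (measurableT_comp (mF i)).
  by apply: measurable_fun_addmx; [exact: measurable_cst|exact: measurable_id].
have mg i : measurable_fun setT (g i).
  apply: emeasurable_funM; last exact: mFc.
  apply/measurable_EFinP; apply: measurable_indic; exact: measurable_cube.
have g0 i z : 0 <= g i z by rewrite mule_ge0// lee_fin.
pose G (y : 'M[R]_(n, d.+2)) := \prod_(i < n) g i (row i y).
have mG : measurable_fun setT G.
  apply: emeasurable_prod_fun => i; apply: (measurableT_comp (mg i)).
  exact: measurable_row.
have G0 y : 0 <= G y by apply: prode_ge0 => i _.
under [in leRHS]eq_bigr do rewrite integral_indicM.
rewrite -(ge0_integral_prod_row mg g0).
apply: le_trans (cone_integral_le n0 mG G0).
have mK := measurable_cone_kernel mG.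
rewrite [leRHS](@fubini_tonelli _ _ _ _ R (leb n d.+2) (leb 1 d.+2) _ mK);
  last first.
  by move=> z; rewrite mule_ge0// lee_fin mulr_ge0.
rewrite integral_indicM.
pose H (z : 'rV[R]_d.+2 * 'M[R]_(n, d.+2)) :=
  \prod_(i < n) F i (c + z.1 - row i (sphere_proj z.2))%R.
have mH : measurable_fun setT H.
  apply: (measurableT_comp (measurable_prod_shift mF)
    (g := fun z : 'rV[R]_d.+2 * 'M[R]_(n, d.+2) => ((c + z.1)%R, z.2))).
  apply: measurable_fun_pair; last exact: measurable_snd.
  by apply: measurable_fun_addmx; [exact: measurable_cst|exact: measurable_fst].
have H0 z : 0 <= H z by apply: prode_ge0 => i _.
have mPH : measurable_fun setT (fun z => (\1_pball z.2)%:E * H z).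
  apply: emeasurable_funM => //; apply/measurable_EFinP.
  apply: measurable_fun_indic_comp; last exact: measurable_snd.
  exact: measurable_punctured_ball.
have PH0 z : 0 <= (\1_pball z.2)%:E * H z by rewrite mule_ge0// lee_fin.
apply: ge0_le_integral; first exact: measurableT.
- by move=> x _; rewrite mule_ge0 ?lee_fin//; apply: integral_ge0 => y _;
    exact: (H0 (x, y)).
- apply: emeasurable_funM.
    by apply/measurable_EFinP; apply: measurable_indic; exact: measurable_cube.
  rewrite (_ : (fun _ => _) = fubini_F (leb n d.+2) (fun z =>
    (\1_pball z.2)%:E * H z)).
    exact: measurable_fun_fubini_tonelli_F.
  by apply/funext => x; rewrite integral_indicM.
- exact: (measurable_fun_fubini_tonelli_G (m1 := leb n d.+2) _ mK
    (fun=> mule_ge0 _ _)).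
move=> x _; rewrite integral_indicM.
have mHx : measurable_fun setT (fun y => (\1_pball y)%:E * H (x, y)).
  exact: (measurable_fun_pair2 (f := fun z => (\1_pball z.2)%:E * H z) x mPH).
rewrite -ge0_integralZl//; last first.
  by move=> y _; exact: (PH0 (x, y)).
apply: ge0_le_integral; first exact: measurableT.
- by move=> y _; rewrite mule_ge0 ?lee_fin//; exact: (PH0 (x, y)).
- by apply: emeasurable_funM => //; exact: measurable_cst.
- exact: (measurable_fun_pair1 x mK).
move=> y _; rewrite muleA -EFinM [(\1__ x * _)%R]mulrC.
have [xQ|xQ] := pselect (cube 1 x); last first.
  by rewrite ![\1_(cube 1) x]indicE memNset// mulr0 !mul0e.
have [yP|yP] := pselect (pball y); last first.
  by rewrite ![\1_pball y]indicE memNset// mul0r !mul0e.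
rewrite lee_wpmul2l ?lee_fin ?mulr_ge0//.
apply: lee_prod => i _; first exact: F0.
rewrite (_ : row i (_ - _) = x - row i (sphere_proj y))%R; last first.
  by apply/rowP => j; rewrite !mxE.
rewrite /g addrA indicE mem_set ?mul1e// => k j; rewrite ord1.
rewrite mxE [(- row i _)%R _ _]mxE [row i _ _ _]mxE.
apply: (le_trans (ler_normB _ _)); rewrite (_ : 2 = 1 + 1)%R// lerD//.
exact: (usphere_cube (sphere_proj_usphere yP)).
Qed.

End product_local.

Section integral_cube.
Context (R : realType) (d : nat).
Local Notation leb m n := (@lebesgue_matrix R m n).

(** This replaces the decomposition of R^d into lattice cubes: all the
    translates of one cube are used, with a continuous parameter. *)
Lemma integral_cube_average (a : R) (h : 'rV[R]_d -> \bar R) : (0 <= a)%R ->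
  measurable_fun setT h -> (forall x, 0 <= h x) ->
  \int[leb 1 d]_c \int[leb 1 d]_(z in cube a) h (c + z)%R =
  ((2 * a) ^+ d)%:E * \int[leb 1 d]_x h x.
Proof.
move=> a0 mh h0.
pose f (z : 'rV[R]_d * 'rV[R]_d) := (\1_(cube a) z.2)%:E * h (z.1 + z.2)%R.
have mf : measurable_fun setT f.
  apply: emeasurable_funM.
    apply/measurable_EFinP; apply: measurable_fun_indic_comp.
      exact: measurable_cube.
    exact: measurable_snd.
  apply: (measurableT_comp mh); apply: measurable_fun_addmx.
    exact: measurable_fst.
  exact: measurable_snd.
have f0 z : 0 <= f z by rewrite mule_ge0// lee_fin.
under eq_integral do rewrite integral_indicM.
rewrite [LHS](@fubini_tonelli _ _ _ _ R (leb 1 d) (leb 1 d) _ mf f0).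
rewrite /f/=; under eq_integral => z _.
  rewrite ge0_integralZl//; last first.
    apply: (measurableT_comp mh).
    by apply: measurable_fun_addmx;
      [exact: measurable_id|exact: measurable_cst].
  rewrite ge0_integral_translate_mx//.
  over.
rewrite -integral_indicM integral_cst; last exact: measurable_cube.
by rewrite [X in _ * X]lebesgue_cube// mul1n muleC.
Qed.

Lemma measurable_integral_cube_shift (a : R) (h : 'rV[R]_d -> \bar R) :
  measurable_fun setT h -> (forall x, 0 <= h x) ->
  measurable_fun setT (fun c : 'rV[R]_d =>
    \int[leb 1 d]_(z in cube a) h (c + z)%R).
Proof.
move=> mh h0.
pose g (z : 'rV[R]_d * 'rV[R]_d) := (\1_(cube a) z.2)%:E * h (z.1 + z.2)%R.
have mg : measurable_fun setT g.
  apply: emeasurable_funM.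
    apply/measurable_EFinP; apply: measurable_fun_indic_comp.
      exact: measurable_cube.
    exact: measurable_snd.
  apply: (measurableT_comp mh); apply: measurable_fun_addmx.
    exact: measurable_fst.
  exact: measurable_snd.
rewrite (_ : (fun _ => _) = fubini_F (leb 1 d) g).
  have g0 z : 0 <= g z by rewrite mule_ge0// lee_fin.
  exact: (measurable_fun_fubini_tonelli_F (m2 := leb 1 d) g mg g0).
by apply/funext => c; rewrite integral_indicM.
Qed.

End integral_cube.

Section average.
Context (R : realType) (n d : nat).
Local Notation leb m n := (@lebesgue_matrix R m n).
Local Notation pball := (@punctured_ball R n d.+2).
Context (f : 'I_n -> 'rV[R]_d.+2 -> R).
Context (mf : forall i, measurable_fun setT (f i)).
Context (f0 : forall i x, (0 <= f i x)%R).

Let mEf i : measurable_fun setT (EFin \o f i).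
Proof. exact/measurable_EFinP. Qed.

Lemma spherical_averageE x : spherical_average f x =
  (n * d.+2)%:R%:E * \int[leb n d.+2]_(y in pball)
    \prod_(i < n) (f i (x - row i (sphere_proj y))%R)%:E.
Proof.
have mh : measurable_fun setT (fun y : 'M[R]_(n, d.+2) =>
    \prod_(i < n) (f i (x - row i y)%R)%:E).
  apply: emeasurable_prod_fun => i; apply: (measurableT_comp (mEf i)).
  by apply: measurable_fun_submx; [exact: measurable_cst|exact: measurable_row].
rewrite -(surface_integralE mh); last first.
  by move=> y; apply: prode_ge0 => i _; rewrite lee_fin.
by apply: eq_integral => y _; rewrite prodEFin.
Qed.

Let mprod : measurable_fun setT (fun z : 'rV[R]_d.+2 * 'M[R]_(n, d.+2) =>
  \prod_(i < n) (f i (z.1 - row i (sphere_proj z.2))%R)%:E).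
Proof. exact: (measurable_prod_shift mEf). Qed.

Let prod_ge0 x y :
  0 <= \prod_(i < n) (f i (x - row i (@sphere_proj R n d.+2 y))%R)%:E.
Proof. by apply: prode_ge0 => i _; rewrite lee_fin. Qed.

Lemma measurable_spherical_average : measurable_fun setT (spherical_average f).
Proof.
rewrite (_ : spherical_average f = fun x => (n * d.+2)%:R%:E *
    \int[leb n d.+2]_y ((\1_pball y)%:E *
    \prod_(i < n) (f i (x - row i (sphere_proj y))%R)%:E)); last first.
  by apply/funext => x; rewrite spherical_averageE integral_indicM.
apply: emeasurable_funM; first exact: measurable_cst.
pose g (z : 'rV[R]_d.+2 * 'M[R]_(n, d.+2)) := (\1_pball z.2)%:E *
  \prod_(i < n) (f i (z.1 - row i (sphere_proj z.2))%R)%:E.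
have mg : measurable_fun setT g.
  apply: emeasurable_funM => //; apply/measurable_EFinP.
  apply: measurable_fun_indic_comp; last exact: measurable_snd.
  exact: measurable_punctured_ball.
apply: (measurable_fun_fubini_tonelli_F (m2 := leb n d.+2) g mg) => z.
by rewrite mule_ge0 ?lee_fin.
Qed.

Lemma spherical_average_ge0 x : 0 <= spherical_average f x.
Proof.
rewrite spherical_averageE mule_ge0 ?lee_fin//.
by apply: integral_ge0 => y _.
Qed.

(** Jensen's inequality on the ball, to pass from the f i to their powers
    f i `^ s with s >= 1. *)
Lemma spherical_average_power_le (s : R) x : (1 <= s)%R ->
  spherical_average f x <=
  (n * d.+2)%:R%:E * leb n d.+2 pball `^ (1 - s^-1) *
  (\int[leb n d.+2]_(y in pball)
    \prod_(i < n) (f i (x - row i (sphere_proj y))%R)%:E `^ s) `^ s^-1.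
Proof.
move=> s1; have s0 : (0 < s)%R by apply: lt_le_trans s1.
rewrite spherical_averageE -muleA lee_wpmul2l ?lee_fin//.
have mpx : measurable_fun setT (fun y : 'M[R]_(n, d.+2) =>
    \prod_(i < n) (f i (x - row i (sphere_proj y))%R)%:E).
  exact: (measurable_fun_pair2 x mprod).
have mg : measurable_fun pball (fun y : 'M[R]_(n, d.+2) =>
    \prod_(i < n) (f i (x - row i (sphere_proj y))%R)%:E `^ s).
  rewrite (_ : (fun _ => _) = fun y => (\prod_(i < n)
      (f i (x - row i (sphere_proj y))%R)%:E) `^ s); last first.
    by apply/funext => y; rewrite poweR_prod// => i; rewrite lee_fin.
  apply: measurable_funTS.
  by apply: (measurableT_comp (f := fun y : \bar R => y `^ s)) => //;
    exact: measurable_poweR.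
apply: (le_trans _ (integral_poweR_le (al := s^-1) (leb n d.+2) _ _ mg _)).
- rewrite le_eqVlt; apply/orP; left; apply/eqP; apply: eq_integral => y _.
  rewrite -poweR_prod; last by move=> i; rewrite lee_fin.
  by rewrite -poweRrM mulfV ?gt_eqF// poweRe1.
- by rewrite invr_ge0 ltW// invf_le1.
- exact: measurable_punctured_ball.
- by move=> y; apply: prode_ge0 => i _; exact: poweR_ge0.
Qed.

End average.

Lemma measurable_fun_poweR (R : realType) d0 (T : measurableType d0) (D : set T)
    (g : T -> \bar R) (r : R) :
  measurable_fun D g -> measurable_fun D (fun x => g x `^ r).
Proof.
by move=> mg; apply: (measurableT_comp (f := fun y : \bar R => y `^ r)) => //;
  exact: measurable_poweR.
Qed.

Lemma measurable_fun_shift (R : realType) d0 (T : measurableType d0) m n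
    (g : 'M[R]_(m, n) -> T) (c : 'M[R]_(m, n)) :
  measurable_fun setT g -> measurable_fun setT (fun z => g (c + z)%R).
Proof.
move=> mg; apply: (measurableT_comp mg).
by apply: measurable_fun_addmx; [exact: measurable_cst|exact: measurable_id].
Qed.

(** Jensen's inequality is applied twice, in y with exponent s^-1 and in x with
    exponent r / s, in order to reach the linear local inequality for the
    functions f i `^ s. *)
Lemma average_power_local (R : realType) (n d : nat) (r : R) :
  (0 < n)%N -> (0 < r)%R -> let s := Num.max 1%R r in
  exists2 K : R, (0 <= K)%R & forall (f : 'I_n -> 'rV[R]_d.+2 -> R) c,
    (forall i, measurable_fun setT (f i)) -> (forall i x, (0 <= f i x)%R) ->
    \int[@lebesgue_matrix R 1 d.+2]_(x in cube 1)
      spherical_average f (c + x)%R `^ r <=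
    K%:E * \prod_(i < n) (\int[@lebesgue_matrix R 1 d.+2]_(z in cube 2)
      (f i (c + z)%R)%:E `^ s) `^ (s^-1 * r).
Proof.
move=> n0 r0 s.
have s1 : (1 <= s)%R by rewrite le_max lexx.
have rs : (r <= s)%R by rewrite le_max lexx orbT.
have s0 : (0 < s)%R by apply: lt_le_trans s1.
set mu1 := @lebesgue_matrix R 1 d.+2; set mun := @lebesgue_matrix R n d.+2.
set al := (s^-1 * r)%R.
have al01 : (0 <= al <= 1)%R.
  rewrite /al ler_pdivrMl// mulr1 rs andbT.
  by apply: mulr_ge0; [rewrite invr_ge0|]; exact: ltW.
have al0 : (0 <= al)%R by case/andP: al01.
pose K1 := (n * d.+2)%:R%:E * mun (@punctured_ball R n d.+2) `^ (1 - s^-1).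
pose K2 := mu1 (cube 1) `^ (1 - al).
pose K3 : \bar R := (4 ^+ d.+2)%:E `^ al.
have K10 : 0 <= K1 by rewrite mule_ge0 ?lee_fin// poweR_ge0.
have K1fin : K1 \is a fin_num.
  by rewrite fin_numM ?fin_num_poweR// lebesgue_punctured_ball_fin.
have K2fin : K2 \is a fin_num.
  by rewrite fin_num_poweR// [X in X \is a fin_num]lebesgue_cube.
have K0 : 0 <= K1 `^ r * (K2 * K3) by rewrite !mule_ge0 ?poweR_ge0.
have KE : (fine (K1 `^ r * (K2 * K3)))%:E = K1 `^ r * (K2 * K3).
  by rewrite fineK// !fin_numM// fin_num_poweR.
exists (fine (K1 `^ r * (K2 * K3))) => [|f c mf f0]; first exact: fine_ge0.
rewrite KE.
pose F i x := (f i x)%:E `^ s.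
have mF i : measurable_fun setT (F i).
  by apply: measurable_fun_poweR; exact/measurable_EFinP.
have F0 i x : 0 <= F i x by exact: poweR_ge0.
pose H (z : 'rV[R]_d.+2 * 'M[R]_(n, d.+2)) :=
  \prod_(i < n) F i (z.1 - row i (sphere_proj z.2))%R.
have H0 z : 0 <= H z by apply: prode_ge0 => i _.
pose B x := \int[mun]_(y in @punctured_ball R n d.+2) H (x, y).
have B0 x : 0 <= B x by apply: integral_ge0 => y _.
have mB : measurable_fun setT B.
  rewrite (_ : B =
    fubini_F mun (fun z => (\1_(@punctured_ball R n d.+2) z.2)%:E * H z)).
    apply: measurable_fun_fubini_tonelli_F.
      apply: emeasurable_funM; last exact: (measurable_prod_shift mF).
      apply/measurable_EFinP; apply: measurable_fun_indic_comp.
        exact: measurable_punctured_ball.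
      exact: measurable_snd.
    by move=> z; rewrite mule_ge0 ?lee_fin.
  by apply/funext => x; rewrite /B integral_indicM.
have mBc := measurable_fun_shift c mB.
apply: (@le_trans _ _ (\int[mu1]_(x in cube 1) (K1 `^ r * B (c + x)%R `^ al))).
  apply: ge0_le_integral; first exact: measurable_cube.
  - by move=> x _; exact: poweR_ge0.
  - apply: measurable_fun_poweR; apply: measurable_funTS.
    apply: measurable_fun_shift; exact: measurable_spherical_average.
  - apply: emeasurable_funM; first exact: measurable_cst.
    by apply: measurable_fun_poweR; exact: measurable_funTS.
  move=> x _; rewrite /al poweRrM -poweRM ?poweR_ge0//.
  apply: ler_poweR; [exact: ltW|exact: spherical_average_ge0|].
  exact: spherical_average_power_le.
rewrite ge0_integralZl; last 4 first.
- exact: measurable_cube.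
- by apply: measurable_fun_poweR; exact: measurable_funTS.
- by move=> x _; exact: poweR_ge0.
- exact: poweR_ge0.
rewrite -muleA lee_wpmul2l ?poweR_ge0//.
apply: (le_trans (integral_poweR_le mu1 al01 (@measurable_cube R _ _ _) _ _)).
- exact: measurable_funTS.
- by move=> x; exact: B0.
rewrite -muleA lee_wpmul2l ?poweR_ge0//.
rewrite -poweR_prod; last by move=> i; apply: integral_ge0 => z _; exact: F0.
rewrite -poweRM; last 2 first.
- by rewrite lee_fin exprn_ge0.
- by apply: prode_ge0 => i _; apply: integral_ge0 => z _; exact: F0.
apply: ler_poweR => //; first by apply: integral_ge0 => x _.
exact: average_local_le.
Qed.

(** The cases of finite and infinite p are given a common form, suited to
    Hoelder's inequality with the weight r / p (which is 0 for infinite p).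
    For finite p, a c is the integral of f `^ p over the cube at c and M = 1;
    for infinite p, a c `^ 0 = 1 and M is the r-th power of the supremum. *)
Lemma local_norm (R : realType) (d : nat) (r : R) (p : \bar R) :
  (0 < r)%R -> 1 <= p -> r%:E <= p ->
  let s := Num.max 1%R r in
  exists2 K : R, (0 <= K)%R & forall f : 'rV[R]_d -> R,
    continuous f -> (forall x, (0 <= f x)%R) ->
    exists (a : 'rV[R]_d -> \bar R) (M : \bar R),
    [/\ measurable_fun setT a, forall c, 0 <= a c, 0 <= M,
     forall c, (\int[@lebesgue_matrix R 1 d]_(z in cube 2)
       (f (c + z)%R)%:E `^ s) `^ (s^-1 * r) <=
         K%:E * (a c `^ (r * fine p^-1) * M) &
     (\int[@lebesgue_matrix R 1 d]_c a c) `^ (r * fine p^-1) * M <=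
       K%:E * 'N[@lebesgue_matrix R 1 d]_p[EFin \o f] `^ r].
Proof.
move=> r0 p1 rp s.
have s1 : (1 <= s)%R by rewrite le_max lexx.
have rs : (r <= s)%R by rewrite le_max lexx orbT.
have s0 : (0 < s)%R by apply: lt_le_trans s1.
have sp : s%:E <= p.
  by rewrite /s; case: (leP 1%R r).
have al0 : (0 <= s^-1 * r)%R.
  by apply: mulr_ge0; [rewrite invr_ge0|]; exact: ltW.
set mu1 := @lebesgue_matrix R 1 d.
have Q2 : mu1 (cube 2) = (4 ^+ d)%:E.
  by rewrite [LHS]lebesgue_cube// mul1n; congr (_ ^+ _)%:E; ring.
case: p p1 rp sp => [p| |] p1 rp sp; last by [].
- rewrite !lee_fin in p1 rp sp.
  have p0 : (0 < p)%R by apply: lt_le_trans p1.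
  have pV : fine (p%:E)^-1 = p^-1%R by rewrite /inve/= gt_eqF.
  rewrite pV {pV}; set th := (r * p^-1)%R.
  have th0 : (0 <= th)%R by rewrite divr_ge0// ltW.
  have be01 : (0 <= s * p^-1 <= 1)%R.
    by rewrite ler_pdivrMr// mul1r sp andbT divr_ge0// ltW.
  have thE : (th = (s * p^-1) * (s^-1 * r))%R.
    by rewrite /th; field; rewrite ?gt_eqF.
  pose Ka : R := (((4 ^+ d) `^ (1 - s * p^-1)) `^ (s^-1 * r))%R.
  pose Kb : R := ((4 ^+ d) `^ th)%R.
  exists (Ka + Kb)%R => [|f cf f0]; first by rewrite addr_ge0// powR_ge0.
  pose F x := (f x)%:E `^ p.
  have mf : measurable_fun setT f := continuous_measurable_mx cf.
  have mF : measurable_fun setT F.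
    by apply: measurable_fun_poweR; exact/measurable_EFinP.
  have F0 x : 0 <= F x by exact: poweR_ge0.
  have a0 c : 0 <= \int[mu1]_(z in cube 2) F (c + z)%R by apply: integral_ge0.
  exists (fun c => \int[mu1]_(z in cube 2) F (c + z)%R), 1; split => //.
  + exact: measurable_integral_cube_shift.
  + move=> c; rewrite mule1.
    apply: (@le_trans _ _
      (Ka%:E * (\int[mu1]_(z in cube 2) F (c + z)%R) `^ th)).
      rewrite thE [X in _ * X]poweRrM /Ka -!poweR_EFin -poweRM ?poweR_ge0 //.
      apply: ler_poweR => //; first by apply: integral_ge0 => z _;
        exact: poweR_ge0.
      apply: (le_trans _
        (le_trans (integral_poweR_le mu1 be01 (@measurable_cube R _ _ _)
         (measurable_funTS (measurable_fun_shift c mF)) _) _)) => //.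
      * rewrite le_eqVlt; apply/orP; left; apply/eqP; apply: eq_integral => z _.
        by rewrite /F -poweRrM; congr (_ `^ _); field; rewrite gt_eqF.
      * by rewrite -Q2.
    by rewrite lee_wpmul2r ?poweR_ge0// lee_fin lerDl powR_ge0.
  + rewrite mule1 (integral_cube_average (ler0n _ 2) mF F0).
    rewrite poweRM ?lee_fin ?exprn_ge0 ?integral_ge0//.
    rewrite lee_pmul ?poweR_ge0//.
      rewrite poweR_EFin lee_fin /Kb (_ : 2 * 2 = 4)%R; last by ring.
      by rewrite lerDr powR_ge0.
    rewrite unlock -poweRrM [(p^-1 * r)%R]mulrC.
    by under [in leRHS]eq_integral do rewrite /= ger0_norm//.
- rewrite (_ : r * fine _ = 0)%R; last by rewrite /inve/= mulr0.
  pose Ka : R := ((4 ^+ d) `^ (s^-1 * r))%R.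
  exists (Ka + 1)%R => [|f cf f0]; first by rewrite addr_ge0// powR_ge0.
  set N := 'N[_]_ _[_].
  have N0 : 0 <= N by exact: Lnorm_ge0.
  have fN x : (f x)%:E <= N by exact: continuous_le_Lnormy.
  have mf : measurable_fun setT f := continuous_measurable_mx cf.
  exists (cst 0), (N `^ r); split => //; first exact: poweR_ge0.
  + move=> c; rewrite poweRe0 mul1e.
    apply: (@le_trans _ _ (Ka%:E * N `^ r)); last first.
      by rewrite lee_wpmul2r ?poweR_ge0// lee_fin lerDl.
    rewrite (_ : N `^ r = (N `^ s) `^ (s^-1 * r)); last first.
      by rewrite -poweRrM mulrA mulfV ?gt_eqF// mul1r.
    rewrite -poweR_EFin -poweRM ?poweR_ge0 ?lee_fin ?exprn_ge0//.
    apply: ler_poweR => //; first by apply: integral_ge0 => z _;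
      exact: poweR_ge0.
    rewrite muleC -Q2 -integral_cst; last exact: measurable_cube.
    apply: ge0_le_integral; first exact: measurable_cube.
    * by move=> z _; exact: poweR_ge0.
    * apply: measurable_fun_poweR; apply/measurable_EFinP;
      apply: measurable_funTS.
      exact: measurable_fun_shift.
    * exact: measurable_cst.
    * by move=> z _; apply: ler_poweR; rewrite ?lee_fin// ltW.
  + by rewrite poweRe0 mul1e -[leLHS]mul1e lee_wpmul2r ?poweR_ge0// lee_fin
    lerDr powR_ge0.
Qed.

(** * The global bound *)

Lemma inve_ge0 (R : realType) (p : \bar R) : 1 <= p -> 0 <= p^-1.
Proof.
case: p => [q| |]; rewrite /inve//= lee_fin => q1.
by rewrite gt_eqF ?lee_fin ?invr_ge0 ?(le_trans _ q1)// (lt_le_trans _ q1).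
Qed.

Lemma inve_fin_num (R : realType) (p : \bar R) : 1 <= p -> p^-1 \is a fin_num.
Proof.
case: p => [q| |]; rewrite /inve//= lee_fin => q1.
by rewrite gt_eqF// (lt_le_trans _ q1).
Qed.

Section spherical_average_bound.
Context (R : realType) (n d : nat).
Local Notation mu1 := (@lebesgue_matrix R 1 d.+2).
Context (n0 : (0 < n)%N).
Context (p : 'I_n -> \bar R).
Context (p1 : forall i, 1 <= p i).

(** Average average_power_local over the centre c of the cube, insert
    local_norm for every factor, and apply Hoelder's inequality in c with the
    weights th i = r / p i. *)
Lemma spherical_average_bound (r : R) : (0 < r)%R ->
  r^-1%:E = \sum_(i < n) (p i)^-1 ->
  exists C : R, forall f : 'I_n -> 'rV[R]_d.+2 -> R,
    (forall i, continuous (f i)) -> (forall i x, (0 <= f i x)%R) ->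
    'N[mu1]_r%:E[spherical_average f] <=
      C%:E * \prod_(i < n) 'N[mu1]_(p i)[EFin \o f i].
Proof.
move=> r0 hr.
have inv_ge0 i := inve_ge0 (p1 i).
have inv_fin i := inve_fin_num (p1 i).
pose th i := (r * fine (p i)^-1)%R.
have th0 i : (0 <= th i)%R by rewrite mulr_ge0 ?fine_ge0// ltW.
have th1 : (\sum_(i < n) th i = 1)%R.
  by rewrite -mulr_sumr sum_fine// -hr/= mulfV// gt_eqF.
have rp i : r%:E <= p i.
  have : (p i)^-1 <= r^-1%:E.
    by rewrite hr (bigD1 i)//= leeDl// sume_ge0.
  have := p1 i; case: (p i) => [q| |]//; last by move=> _ _; exact: leey.
  rewrite /inve/= !lee_fin => q1; have q0 : (0 < q)%R by exact: lt_le_trans q1.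
  by rewrite gt_eqF// lee_fin lef_pV2 ?posrE.
have [K0 K00 K0P] := average_power_local d n0 r0.
have exK i : exists K : R, (0 <= K)%R /\ forall f : 'rV[R]_d.+2 -> R,
    continuous f -> (forall x, (0 <= f x)%R) ->
    exists aM : ('rV[R]_d.+2 -> \bar R) * \bar R,
    [/\ measurable_fun setT aM.1, forall c, 0 <= aM.1 c, 0 <= aM.2,
     forall c, (\int[mu1]_(z in cube 2)
       (f (c + z)%R)%:E `^ (Num.max 1 r)%R) `^ ((Num.max 1 r)^-1 * r)%R
       <= (K%:E) * (aM.1 c `^ th i * aM.2) &
     (\int[mu1]_c aM.1 c) `^ th i * aM.2 <=
       K%:E * 'N[mu1]_(p i)[EFin \o f] `^ r].
  have [K K1 KP] := local_norm d.+2 r0 (p1 i) (rp i).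
  exists K; split => // f cf f0; have [a [M aMP]] := KP f cf f0.
  by exists (a, M).
have [K KP] := choice exK.
pose C1 := (K0 * (\prod_(i < n) K i * \prod_(i < n) K i))%R.
have Kp0 : (0 <= \prod_(i < n) K i)%R.
  by apply: prodr_ge0 => i _; have [] := KP i.
have C10 : (0 <= C1)%R by rewrite !mulr_ge0.
exists (C1 `^ r^-1)%R => f cf f0.
have mf i : measurable_fun setT (f i) := continuous_measurable_mx (cf i).
have [aM aMP] := choice (fun i => (KP i).2 (f i) (cf i) (f0 i)).
pose N i := 'N[mu1]_(p i)[EFin \o f i].
have N0 i : 0 <= N i by exact: Lnorm_ge0.
pose A := spherical_average f.
have A0 x : 0 <= A x by exact: spherical_average_ge0.
have mA : measurable_fun setT A by exact: measurable_spherical_average.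
have mAr : measurable_fun setT (fun x => A x `^ r).
  exact: measurable_fun_poweR.
have ma i : measurable_fun setT (aM i).1 by have [] := aMP i.
have a0 i c : 0 <= (aM i).1 c by have [] := aMP i.
have M0 i : 0 <= (aM i).2 by have [] := aMP i.
have mprod : measurable_fun setT (fun c => \prod_(i < n) (aM i).1 c `^ th i).
  by apply: emeasurable_prod_fun => i; exact: measurable_fun_poweR.
have prod0 c : 0 <= \prod_(i < n) (aM i).1 c `^ th i.
  by apply: prode_ge0 => i _; exact: poweR_ge0.
have KM0 : 0 <= (K0 * \prod_(i < n) K i)%:E * \prod_(i < n) (aM i).2.
  by rewrite mule_ge0 ?lee_fin ?mulr_ge0// prode_ge0.
have main : \int[mu1]_x A x `^ r <= C1%:E * (\prod_(i < n) N i) `^ r.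
  apply: (@le_trans _ _ (((2 * 1) ^+ d.+2)%:E * \int[mu1]_x A x `^ r)).
    rewrite -[leLHS]mul1e lee_pmul// ?integral_ge0// => [x _|].
      exact: poweR_ge0.
    by rewrite lee_fin mulr1 exprn_ege1// ler1n.
  rewrite -integral_cube_average//; last by move=> x; exact: poweR_ge0.
  apply: (@le_trans _ _ (\int[mu1]_c ((K0 * \prod_(i < n) K i)%:E *
      \prod_(i < n) (aM i).2 * \prod_(i < n) (aM i).1 c `^ th i))).
    apply: ge0_le_integral; first exact: measurableT.
    - by move=> c _; apply: integral_ge0 => x _; exact: poweR_ge0.
    - exact: (measurable_integral_cube_shift 1 mAr (fun=> poweR_ge0 _ _)).
    - by apply: emeasurable_funM => //; exact: measurable_cst.
    move=> c _; apply: (le_trans (K0P f c mf f0)).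
    rewrite EFinM -!muleA lee_wpmul2l ?lee_fin//.
    rewrite -prodEFin -!big_split/=; apply: lee_prod => i _;
      first exact: poweR_ge0.
    by have [_ _ _ + _] := aMP i; rewrite [(aM i).2 * _]muleC; apply.
  rewrite ge0_integralZl//.
  apply: (@le_trans _ _ ((K0 * \prod_(i < n) K i)%:E * \prod_(i < n) (aM i).2 *
      \prod_(i < n) (\int[mu1]_c (aM i).1 c) `^ th i)).
    by rewrite lee_wpmul2l//; exact: ge0_hoelder.
  rewrite -muleA -big_split/= /C1 mulrA [in leRHS]EFinM -muleA.
  rewrite lee_wpmul2l ?lee_fin ?mulr_ge0//.
  rewrite poweR_prod// -prodEFin -big_split/=; apply: lee_prod => i _.
    by rewrite mule_ge0// poweR_ge0.
  by rewrite muleC; have [] := aMP i.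
rewrite [in leLHS]unlock.
under eq_integral do rewrite gee0_abs//.
apply: (le_trans (ler_poweR _ _ main)).
- by rewrite invr_ge0 ltW.
- by apply: integral_ge0 => x _; exact: poweR_ge0.
rewrite poweRM ?lee_fin ?poweR_ge0// -poweRrM mulfV ?gt_eqF//.
by rewrite poweRe1// prode_ge0.
Qed.

End spherical_average_bound.

Lemma spherical_average_bound_oo (R : realType) (n d : nat) :
  exists C : R, forall f : 'I_n -> 'rV[R]_d.+2 -> R,
    (forall i, continuous (f i)) -> (forall i x, (0 <= f i x)%R) ->
    'N[@lebesgue_matrix R 1 d.+2]_+oo[spherical_average f] <=
      C%:E * \prod_(i < n) 'N[@lebesgue_matrix R 1 d.+2]_+oo[EFin \o f i].
Proof.
set mu1 := @lebesgue_matrix R 1 d.+2.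
pose B := @lebesgue_matrix R n d.+2 (@punctured_ball R n d.+2).
have B0 : 0 <= B by exact: measure_ge0.
have BE : (fine B)%:E = B.
  by rewrite fineK//; exact: lebesgue_punctured_ball_fin.
exists ((n * d.+2)%:R * fine B)%R => f cf f0.
have mf i : measurable_fun setT (f i) := continuous_measurable_mx (cf i).
set N := \prod_(i < n) _.
have N0 : 0 <= N by apply: prode_ge0 => i _; exact: Lnorm_ge0.
have AN x : spherical_average f x <= ((n * d.+2)%:R * fine B)%:E * N.
  rewrite spherical_averageE// EFinM BE -muleA lee_wpmul2l ?lee_fin// muleC.
  rewrite -integral_cst; last exact: measurable_punctured_ball.
  apply: ge0_le_integral; first exact: measurable_punctured_ball.
  - by move=> y _; apply: prode_ge0 => i _; rewrite lee_fin.
  - apply: measurable_funTS.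
    have mEf i : measurable_fun setT (EFin \o f i) by exact/measurable_EFinP.
    exact: (measurable_fun_pair2 x (measurable_prod_shift mEf)).
  - exact: measurable_cst.
  move=> y _; apply: lee_prod => i _; first by rewrite lee_fin.
  exact: continuous_le_Lnormy.
rewrite unlock; case: ifPn => _; last first.
  by rewrite mule_ge0 ?lee_fin ?mulr_ge0 ?fine_ge0.
apply/ess_supP/nearW => x /=; rewrite gee0_abs//.
exact: spherical_average_ge0.
Qed.

Theorem theorem1 (R : realType) (d n : nat) (p : 'I_n -> \bar R) (r : \bar R)
    (hd : (2 <= d)%N) (hn : (1 <= n)%N) (hp : forall i, 1 <= p i)
    (hr0 : 0 < r) (hr : r^-1 = \sum_(i < n) (p i)^-1) :
  exists C : R, forall f : 'I_n -> 'rV[R]_d -> R,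
    (forall i, schwartz (f i)) -> (forall i x, (0 <= f i x)%R) ->
    'N[@lebesgue_matrix R 1 d]_r[spherical_average f] <=
      C%:E * \prod_(i < n) 'N[@lebesgue_matrix R 1 d]_(p i)[EFin \o f i].
Proof.
case: d hd => [//|[//|d]] _.
have schwartz_continuous (f : 'rV[R]_d.+2 -> R) : schwartz f -> continuous f.
  by move=> [/(_ [::])[]].
suff [C CP] : exists C : R, forall f : 'I_n -> 'rV[R]_d.+2 -> R,
    (forall i, continuous (f i)) -> (forall i x, (0 <= f i x)%R) ->
    'N[@lebesgue_matrix R 1 d.+2]_r[spherical_average f] <=
      C%:E * \prod_(i < n) 'N[@lebesgue_matrix R 1 d.+2]_(p i)[EFin \o f i].
  by exists C => f sf f0; apply: CP => // i; exact: schwartz_continuous.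
case: r hr0 hr => [r| |//] r0 hr.
  rewrite lte_fin in r0; apply: spherical_average_bound => //.
  by rewrite -hr /inve gt_eqF.
have inv_ge0 i := inve_ge0 (hp i).
have poo i : p i = +oo.
  have : (p i)^-1 <= 0.
    by rewrite (_ : 0 = +oo^-1)// hr (bigD1 i)//= leeDl// sume_ge0.
  have := hp i; case: (p i) => [q| |]//; rewrite lee_fin => q1.
  have q0 : (0 < q)%R by exact: lt_le_trans q1.
  by rewrite /inve gt_eqF// lee_fin leNgt invr_gt0 q0.
have [C CP] := spherical_average_bound_oo R n d.
by exists C => f cf f0; under eq_bigr do rewrite poo; exact: CP.
Qed.
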